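(* Let $(M_i,g_i)$ be an $n_i$-dimensional Einstein manifold with $\operatorname{Ric}(g_i)=\rho_i g_i$ and $n_i\geq 1$ for $i=1,2$. Denote by $\mathring{R}_i$ the curvature operator of the second kind of $M_i$ for $i=1,2$, and by $\mathring{R}$ the curvature operator of the second kind of the product manifold $(M^{n_1+n_2},g)=(M_1^{n_1}\times M_2^{n_2},g_1\oplus g_2)$. Then the eigenvalues of $\mathring{R}$ (at a point $(p_1,p_2)$, counted with multiplicity) are precisely those of $\mathring{R}_1$ (at $p_1$) and $\mathring{R}_2$ (at $p_2$), together with $0$ with multiplicity $n_1n_2$, and $-\frac{n_1\rho_2+n_2\rho_1}{n_1+n_2}$ with multiplicity one.
   Context: The sign convention for the Riemann curvature tensor is that $R_{ijij}$ is the sectional curvature of the plane spanned by orthonormal $e_i,e_j$ (so the unit sphere has positive Ricci curvature). For a Riemannian manifold $M$ and $p\in M$, $S^2_0(T_pM)$ is the space of traceless symmetric two-tensors on $T_pM$ (which is zero if $\dim M=1$). The curvature operator of the second kind at $p$ is the symmetric bilinear form on $S^2_0(T_pM)$ given, in an orthonormal basis of $T_pM$, by $\mathring{R}(\varphi,\psi)=\sum_{i,j,k,l}R_{ijkl}\varphi_{il}\psi_{jk}$; its eigenvalues are taken with respect to the inner product $\langle\varphi,\psi\rangle=\sum_{i,j}\varphi_{ij}\psi_{ij}$ on $S^2_0(T_pM)$. *)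

(* Defs.v *)
From HB Require Import structures.
From mathcomp Require Import all_boot all_order all_algebra.
From mathcomp Require Import all_classical all_reals all_analysis.
From mathcomp Require Import ring.

Set Implicit Arguments.
Unset Strict Implicit.
Unset Printing Implicit Defensive.

Import Order.TTheory GRing.Theory Num.Theory.
Import numFieldNormedType.Exports.

Local Open Scope classical_set_scope.
Local Open Scope ring_scope.

Definition pderiv (R : realType) (n : nat) (i : 'I_n) (f : 'rV[R]_n -> R) :
  'rV[R]_n -> R := fun x => 'D_(delta_mx 0 i) f x.

Fixpoint Cn (R : realType) (n k : nat) (U : set 'rV[R]_n) (f : 'rV[R]_n -> R) :
    Prop :=
  (forall x, U x -> {for x, continuous f}) /\
  if k is k'.+1 then
    forall i : 'I_n, (forall x, U x -> derivable f x (delta_mx 0 i)) /\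
                     Cn k' U (pderiv i f)
  else True.

Definition smooth (R : realType) (n : nat) (U : set 'rV[R]_n)
  (f : 'rV[R]_n -> R) : Prop := forall k : nat, Cn k U f.

(* Points of R^n are rows, so row [i] is the image of the [i]-th basis vector. *)
Definition jacobian_mx (R : realType) (n : nat) (F : 'rV[R]_n -> 'rV[R]_n)
    (x : 'rV[R]_n) : 'M[R]_n :=
  \matrix_(i, j) pderiv i (fun y => F y 0 j) x.

(* A manifold is a space with a smooth atlas.  A Riemannian metric is the family
   of its coordinate Gram matrices (g(d_i, d_j)), one function per chart, that
   obey the transformation rule of a covariant two-tensor.  Each point has a
   preferred chart, whose coordinate frame identifies the tangent space at the
   point with R^n. *)
Record riemannian_manifold (R : realType) (n : nat) := RiemannianManifold {
  space :> topologicalType ;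
  space_hausdorff : hausdorff_space space ;
  space_second_countable : @second_countable space ;
  chart_index : Type ;
  chart_dom : chart_index -> set space ;
  chart : chart_index -> space -> 'rV[R]_n ;
  chart_inv : chart_index -> 'rV[R]_n -> space ;
  chart_at : space -> chart_index ;
  chart_dom_at : forall p, chart_dom (chart_at p) p ;
  chart_dom_open : forall a, open (chart_dom a) ;
  chart_img_open : forall a, open (chart a @` chart_dom a) ;
  chartK : forall a p, chart_dom a p -> chart_inv a (chart a p) = p ;
  chart_continuous :
    forall a p, chart_dom a p -> {for p, continuous (chart a)} ;
  chart_inv_continuous :
    forall a x, (chart a @` chart_dom a) x -> {for x, continuous (chart_inv a)} ;
  transition_smooth : forall a b (j : 'I_n),
    smooth (chart a @` (chart_dom a `&` chart_dom b))
           (fun x => chart b (chart_inv a x) 0 j) ;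
  metric : chart_index -> 'rV[R]_n -> 'M[R]_n ;
  metric_smooth : forall a (i j : 'I_n),
    smooth (chart a @` chart_dom a) (fun x => metric a x i j) ;
  metric_sym : forall a x, (chart a @` chart_dom a) x ->
    (metric a x)^T = metric a x ;
  metric_posdef : forall a x, (chart a @` chart_dom a) x ->
    forall v : 'rV[R]_n, v != 0 -> 0 < (v *m metric a x *m v^T) 0 0 ;
  metric_change : forall a b x,
    (chart a @` (chart_dom a `&` chart_dom b)) x ->
    let tau := fun y => chart b (chart_inv a y) in
    metric a x =
      jacobian_mx tau x *m metric b (tau x) *m (jacobian_mx tau x)^T }.

Section Product.
Variables (R : realType) (n1 n2 : nat).

Lemma quot_lsubmx_l (i : 'I_n1) (f : 'rV[R]_n1 -> R) (x : 'rV[R]_(n1 + n2)) :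
  (fun h : R => h^-1 *: (((f \o lsubmx) \o shift x)
     (h *: delta_mx 0 (lshift n2 i)) - (f \o lsubmx) x)) =
  (fun h : R => h^-1 *: ((f \o shift (lsubmx x)) (h *: delta_mx 0 i) -
     f (lsubmx x))).
Proof.
apply/funext => h /=; congr (_ *: (f _ - _)).
by apply/rowP => j; rewrite !mxE !eqxx /= (inj_eq (@lshift_inj _ _)).
Qed.

Lemma quot_lsubmx_r (i : 'I_n2) (f : 'rV[R]_n1 -> R) (x : 'rV[R]_(n1 + n2)) :
  (fun h : R => h^-1 *: (((f \o lsubmx) \o shift x)
     (h *: delta_mx 0 (rshift n1 i)) - (f \o lsubmx) x)) = cst 0.
Proof.
apply/funext => h /=; rewrite (_ : lsubmx _ = lsubmx x) ?subrr ?scaler0 //.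
by apply/rowP => j; rewrite !mxE eqxx /= eq_lrshift mulr0 add0r.
Qed.

Lemma quot_rsubmx_r (i : 'I_n2) (f : 'rV[R]_n2 -> R) (x : 'rV[R]_(n1 + n2)) :
  (fun h : R => h^-1 *: (((f \o rsubmx) \o shift x)
     (h *: delta_mx 0 (rshift n1 i)) - (f \o rsubmx) x)) =
  (fun h : R => h^-1 *: ((f \o shift (rsubmx x)) (h *: delta_mx 0 i) -
     f (rsubmx x))).
Proof.
apply/funext => h /=; congr (_ *: (f _ - _)).
by apply/rowP => j; rewrite !mxE !eqxx /= (inj_eq (@rshift_inj _ _)).
Qed.

Lemma quot_rsubmx_l (i : 'I_n1) (f : 'rV[R]_n2 -> R) (x : 'rV[R]_(n1 + n2)) :
  (fun h : R => h^-1 *: (((f \o rsubmx) \o shift x)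
     (h *: delta_mx 0 (lshift n2 i)) - (f \o rsubmx) x)) = cst 0.
Proof.
apply/funext => h /=; rewrite (_ : rsubmx _ = rsubmx x) ?subrr ?scaler0 //.
by apply/rowP => j; rewrite !mxE eqxx /= eq_rlshift mulr0 add0r.
Qed.

Lemma pderiv_lsubmx_l (i : 'I_n1) (f : 'rV[R]_n1 -> R) :
  pderiv (lshift n2 i) (f \o lsubmx) = pderiv i f \o lsubmx.
Proof. by apply/funext => x; rewrite /pderiv/= /derive quot_lsubmx_l. Qed.

Lemma pderiv_lsubmx_r (i : 'I_n2) (f : 'rV[R]_n1 -> R) :
  pderiv (rshift n1 i) (f \o lsubmx) = cst 0.
Proof.
apply/funext => x; rewrite /pderiv /derive quot_lsubmx_r.
exact: (@lim_cst _ (@norm_hausdorff _ _) _ _ _ (0 : R)).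
Qed.

Lemma pderiv_rsubmx_r (i : 'I_n2) (f : 'rV[R]_n2 -> R) :
  pderiv (rshift n1 i) (f \o rsubmx) = pderiv i f \o rsubmx.
Proof. by apply/funext => x; rewrite /pderiv/= /derive quot_rsubmx_r. Qed.

Lemma pderiv_rsubmx_l (i : 'I_n1) (f : 'rV[R]_n2 -> R) :
  pderiv (lshift n2 i) (f \o rsubmx) = cst 0.
Proof.
apply/funext => x; rewrite /pderiv /derive quot_rsubmx_l.
exact: (@lim_cst _ (@norm_hausdorff _ _) _ _ _ (0 : R)).
Qed.

Lemma Cn_cst (n k : nat) (U : set 'rV[R]_n) (c : R) : Cn k U (cst c).
Proof.
elim: k c => [|k IHk] c; split.
- by move=> x _; exact: (@cst_continuous _ _ c).
- by [].
- by move=> x _; exact: (@cst_continuous _ _ c).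
move=> i; split; first by move=> x _; exact: (@derivable_cst R 'rV[R]_n R c).
rewrite (_ : pderiv i _ = cst 0); first exact: IHk.
by apply/funext => x; rewrite /pderiv (@derive_cst R 'rV[R]_n R c).
Qed.

Lemma Cn_sub (n k : nat) (U V : set 'rV[R]_n) (f : 'rV[R]_n -> R) :
  U `<=` V -> Cn k V f -> Cn k U f.
Proof.
move=> UV; elim: k f => [|k IHk] f [cf df]; split=> //; try by move=> x /UV /cf.
by move=> i; have [d1 d2] := df i; split; [move=> x /UV /d1|exact: IHk].
Qed.

Lemma Cn_lsubmx (k : nat) (U : set 'rV[R]_n1) (f : 'rV[R]_n1 -> R) :
  Cn k U f -> Cn k (@lsubmx R 1 n1 n2 @^-1` U) (f \o lsubmx).
Proof.
elim: k f => [|k IHk] f [cf df]; split=> //.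
- by move=> x Ux; apply: continuous_comp; [exact: continuous_lsubmx|exact: cf].
- by move=> x Ux; apply: continuous_comp; [exact: continuous_lsubmx|exact: cf].
move=> i; case: (split_ordP i) => {}i ->.
  rewrite pderiv_lsubmx_l; have [d1 d2] := df i; split; last exact: IHk.
  by move=> x /d1; rewrite /derivable quot_lsubmx_l.
rewrite pderiv_lsubmx_r; split; last exact: Cn_cst.
by move=> x _; rewrite /derivable quot_lsubmx_r; exact: is_cvg_cst.
Qed.

Lemma Cn_rsubmx (k : nat) (U : set 'rV[R]_n2) (f : 'rV[R]_n2 -> R) :
  Cn k U f -> Cn k (@rsubmx R 1 n1 n2 @^-1` U) (f \o rsubmx).
Proof.
elim: k f => [|k IHk] f [cf df]; split=> //.
- by move=> x Ux; apply: continuous_comp; [exact: continuous_rsubmx|exact: cf].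
- by move=> x Ux; apply: continuous_comp; [exact: continuous_rsubmx|exact: cf].
move=> i; case: (split_ordP i) => {}i ->.
  rewrite pderiv_rsubmx_l; split; last exact: Cn_cst.
  by move=> x _; rewrite /derivable quot_rsubmx_l; exact: is_cvg_cst.
rewrite pderiv_rsubmx_r; have [d1 d2] := df i; split; last exact: IHk.
by move=> x /d1; rewrite /derivable quot_rsubmx_r.
Qed.

Lemma cvg_row_mx (T : Type) (F : set_system T) (FF : Filter F)
    (f : T -> 'rV[R]_n1) (g : T -> 'rV[R]_n2)
    (u : 'rV[R]_n1) (v : 'rV[R]_n2) :
  f @ F --> u -> g @ F --> v ->
  (fun t => row_mx (f t) (g t) : 'rV[R]_(n1 + n2)) @ F -->
  (row_mx u v : 'rV[R]_(n1 + n2)).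
Proof.
move=> fu gv; apply/cvg_ballP => e e0.
have fe : \forall t \near F, ball u e (f t) by move/cvg_ballP: fu; exact.
have ge : \forall t \near F, ball v e (g t) by move/cvg_ballP: gv; exact.
near=> t.
have [_ ft] : ball u e (f t) by near: t.
have [_ gt] : ball v e (g t) by near: t.
split=> // i j; case: (split_ordP j) => {}j ->.
  by rewrite !row_mxEl.
by rewrite !row_mxEr.
Unshelve. all: by end_near. Qed.

Lemma hausdorff_prod (S T : topologicalType) :
  hausdorff_space S -> hausdorff_space T -> hausdorff_space (S * T)%type.
Proof.
move=> hS hT [p1 p2] [q1 q2] cpq; congr (_, _).
  apply: hS => A B pA qB.
  have [[x1 x2] [/= Ax Bx]] := cpq (fst @^-1` A) (fst @^-1` B)
    (cvg_fst pA) (cvg_fst qB).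
  by exists x1.
apply: hT => A B pA qB.
have [[x1 x2] [/= Ax Bx]] := cpq (snd @^-1` A) (snd @^-1` B)
  (cvg_snd pA) (cvg_snd qB).
by exists x2.
Qed.

Lemma openX (S T : topologicalType) (A : set S) (B : set T) :
  open A -> open B -> open (A `*` B).
Proof.
rewrite !openE => oA oB [x y] [/= /oA xA /oB yB].
by exists (A, B).
Qed.

Lemma second_countable_prod (S T : topologicalType) :
  @second_countable S -> @second_countable T ->
  @second_countable (S * T)%type.
Proof.
move=> [B cB [oB bB]] [C cC [oC bC]].
exists ((fun UV => UV.1 `*` UV.2) @` (B `*` C)).
  exact/(sub_countable (card_image_le _ _))/countableX.
split=> [_ [[U V] [/= /oB ? /oC ?] <-]|[x y] A [[U V] /= [xU yV] UVA]].
  exact: openX.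
have [U' [BU' U'x] U'U] := bB x _ xU.
have [V' [CV' V'y] V'V] := bC y _ yV.
exists (U' `*` V'); first by split => //; exists (U', V').
by move=> [a b] [/= /U'U Ua /V'V Vb]; exact: UVA.
Qed.

Variables (M1 : riemannian_manifold R n1) (M2 : riemannian_manifold R n2).

Definition prod_dom (a : chart_index M1 * chart_index M2) : set (M1 * M2) :=
  chart_dom a.1 `*` chart_dom a.2.

Definition prod_chart (a : chart_index M1 * chart_index M2) (p : M1 * M2) :
  'rV[R]_(n1 + n2) := row_mx (chart a.1 p.1) (chart a.2 p.2).

Definition prod_chart_inv (a : chart_index M1 * chart_index M2)
  (x : 'rV[R]_(n1 + n2)) : M1 * M2 :=
  (chart_inv a.1 (lsubmx x), chart_inv a.2 (rsubmx x)).

Definition prod_metric (a : chart_index M1 * chart_index M2)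
    (x : 'rV[R]_(n1 + n2)) : 'M[R]_(n1 + n2) :=
  block_mx (metric a.1 (lsubmx x)) 0 0 (metric a.2 (rsubmx x)).

Lemma prod_chart_image a (D1 : set M1) (D2 : set M2) :
  prod_chart a @` (D1 `*` D2) =
  (@lsubmx R 1 n1 n2 @^-1` (chart a.1 @` D1)) `&`
  (@rsubmx R 1 n1 n2 @^-1` (chart a.2 @` D2)).
Proof.
apply/seteqP; split=> [_ [[p1 p2] [/= D1p D2p] <-]|
    x [/= [p1 D1p e1] [p2 D2p e2]]].
  by split=> /=; rewrite /prod_chart ?row_mxKl ?row_mxKr; [exists p1|exists p2].
by exists (p1, p2) => //; rewrite /prod_chart /= e1 e2 hsubmxK.
Qed.

Lemma prod_domI a b : prod_dom a `&` prod_dom b =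
  (chart_dom a.1 `&` chart_dom b.1) `*` (chart_dom a.2 `&` chart_dom b.2).
Proof. by apply/seteqP; split=> -[p1 p2] [[? ?] [? ?]]. Qed.

Lemma prod_chart_dom_at (p : M1 * M2) : prod_dom (chart_at p.1, chart_at p.2) p.
Proof. by split; exact: chart_dom_at. Qed.

Lemma prod_dom_open a : open (prod_dom a).
Proof. by apply: openX; exact: chart_dom_open. Qed.

Lemma prod_img_open a : open (prod_chart a @` prod_dom a).
Proof.
rewrite prod_chart_image; apply: openI; apply: open_comp; rewrite ?in_setE;
  try exact: chart_img_open; move=> x _.
- exact: continuous_lsubmx.
- exact: continuous_rsubmx.
Qed.

Lemma prod_chartK a p : prod_dom a p -> prod_chart_inv a (prod_chart a p) = p.
Proof.
case: p => p1 p2 [/= d1 d2].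
by rewrite /prod_chart_inv /prod_chart /= row_mxKl row_mxKr !chartK.
Qed.

Lemma prod_chart_continuous a p :
  prod_dom a p -> {for p, continuous (prod_chart a)}.
Proof.
case: p => p1 p2 [/= d1 d2]; apply: cvg_row_mx => /=.
  by apply: (cvg_comp _ _ cvg_fst); exact: chart_continuous.
by apply: (cvg_comp _ _ cvg_snd); exact: chart_continuous.
Qed.

Lemma prod_chart_inv_continuous a x :
  (prod_chart a @` prod_dom a) x -> {for x, continuous (prod_chart_inv a)}.
Proof.
rewrite prod_chart_image => -[/= i1 i2].
have c1 := cvg_comp _ _ (@continuous_lsubmx R 1 n1 n2 x)
  (chart_inv_continuous i1).
have c2 := cvg_comp _ _ (@continuous_rsubmx R 1 n1 n2 x)
  (chart_inv_continuous i2).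
exact: (@cvg_pair _ _ _ (nbhs x) _ _ _ _ _ (fun y => chart_inv a.1 (lsubmx y))
  (fun y => chart_inv a.2 (rsubmx y)) c1 c2).
Qed.

Lemma prod_transition_smooth a b (j : 'I_(n1 + n2)) :
  smooth (prod_chart a @` (prod_dom a `&` prod_dom b))
         (fun x => prod_chart b (prod_chart_inv a x) 0 j).
Proof.
rewrite prod_domI prod_chart_image => k; case: (split_ordP j) => {}j ->.
  rewrite (_ : (fun x => _) =
    (fun x => chart b.1 (chart_inv a.1 x) 0 j) \o lsubmx); last first.
    by apply/funext => x; rewrite /prod_chart row_mxEl.
  exact: (Cn_sub (@subIsetl _ _ _) (Cn_lsubmx (transition_smooth _ _ _ k))).
rewrite (_ : (fun x => _) =
  (fun x => chart b.2 (chart_inv a.2 x) 0 j) \o rsubmx); last first.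
  by apply/funext => x; rewrite /prod_chart row_mxEr.
exact: (Cn_sub (@subIsetr _ _ _) (Cn_rsubmx (transition_smooth _ _ _ k))).
Qed.

Lemma prod_metric_smooth a (i j : 'I_(n1 + n2)) :
  smooth (prod_chart a @` prod_dom a) (fun x => prod_metric a x i j).
Proof.
rewrite prod_chart_image => k.
case: (split_ordP i) => {}i ->; case: (split_ordP j) => {}j ->.
- rewrite (_ : (fun x => _) = (fun x => metric a.1 x i j) \o lsubmx); last first.
    by apply/funext => x; rewrite /prod_metric block_mxEul.
  exact: (Cn_sub (@subIsetl _ _ _) (Cn_lsubmx (metric_smooth _ _ _ k))).
- rewrite (_ : (fun x => _) = cst 0); first exact: Cn_cst.
  by apply/funext => x; rewrite /prod_metric block_mxEur mxE.
- rewrite (_ : (fun x => _) = cst 0); first exact: Cn_cst.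
  by apply/funext => x; rewrite /prod_metric block_mxEdl mxE.
- rewrite (_ : (fun x => _) = (fun x => metric a.2 x i j) \o rsubmx); last first.
    by apply/funext => x; rewrite /prod_metric block_mxEdr.
  exact: (Cn_sub (@subIsetr _ _ _) (Cn_rsubmx (metric_smooth _ _ _ k))).
Qed.

Lemma prod_metric_sym a x : (prod_chart a @` prod_dom a) x ->
  (prod_metric a x)^T = prod_metric a x.
Proof.
rewrite prod_chart_image => -[/= i1 i2].
by rewrite /prod_metric tr_block_mx !trmx0 !metric_sym.
Qed.

Lemma prod_metric_posdef a x : (prod_chart a @` prod_dom a) x ->
  forall v : 'rV[R]_(n1 + n2), v != 0 ->
  0 < (v *m prod_metric a x *m v^T) 0 0.
Proof.
rewrite prod_chart_image => -[/= i1 i2] v.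
rewrite /prod_metric -(hsubmxK v) mul_row_block !mulmx0 add0r addr0 tr_row_mx.
rewrite mul_row_col [X in 0 < X]mxE => v0.
have [l0|l0] := eqVneq (lsubmx v) 0.
  rewrite l0 !mul0mx mxE add0r; apply: metric_posdef => //.
  by apply: contraNneq v0 => r0; rewrite l0 r0 row_mx0.
apply: ltr_wpDr; last exact: metric_posdef.
have [->|r0] := eqVneq (rsubmx v) 0; first by rewrite !mul0mx mxE.
exact/ltW/metric_posdef.
Qed.

Lemma prod_jacobian a b x :
  jacobian_mx (fun y => prod_chart b (prod_chart_inv a y)) x =
  block_mx (jacobian_mx (fun y => chart b.1 (chart_inv a.1 y)) (lsubmx x)) 0 0
           (jacobian_mx (fun y => chart b.2 (chart_inv a.2 y)) (rsubmx x)).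
Proof.
have tl j : (fun y => prod_chart b (prod_chart_inv a y) 0 (lshift n2 j)) =
    (fun y => chart b.1 (chart_inv a.1 y) 0 j) \o lsubmx.
  by apply/funext => y; rewrite /prod_chart row_mxEl.
have tr j : (fun y => prod_chart b (prod_chart_inv a y) 0 (rshift n1 j)) =
    (fun y => chart b.2 (chart_inv a.2 y) 0 j) \o rsubmx.
  by apply/funext => y; rewrite /prod_chart row_mxEr.
apply/matrixP => i j; rewrite mxE.
case: (split_ordP i) => {}i ->; case: (split_ordP j) => {}j ->.
- by rewrite block_mxEul mxE tl pderiv_lsubmx_l.
- by rewrite block_mxEur mxE tr pderiv_rsubmx_l.
- by rewrite block_mxEdl mxE tl pderiv_lsubmx_r.
- by rewrite block_mxEdr mxE tr pderiv_rsubmx_r.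
Qed.

Lemma prod_metric_change a b x :
  (prod_chart a @` (prod_dom a `&` prod_dom b)) x ->
  let tau := fun y => prod_chart b (prod_chart_inv a y) in
  prod_metric a x =
    jacobian_mx tau x *m prod_metric b (tau x) *m (jacobian_mx tau x)^T.
Proof.
rewrite prod_domI prod_chart_image => -[/= i1 i2].
rewrite prod_jacobian /prod_metric tr_block_mx !trmx0 !mulmx_block.
rewrite !(mul0mx, mulmx0, addr0, add0r) /prod_chart /= row_mxKl row_mxKr.
by rewrite (metric_change i1) (metric_change i2).
Qed.

Definition prod_manifold : riemannian_manifold R (n1 + n2) :=
  @RiemannianManifold R (n1 + n2) (M1 * M2)%type
    (hausdorff_prod (@space_hausdorff _ _ M1) (@space_hausdorff _ _ M2))
    (second_countable_prod (@space_second_countable _ _ M1)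
                           (@space_second_countable _ _ M2))
    (chart_index M1 * chart_index M2)%type prod_dom prod_chart prod_chart_inv
    (fun p => (chart_at p.1, chart_at p.2)) prod_chart_dom_at prod_dom_open
    prod_img_open prod_chartK prod_chart_continuous prod_chart_inv_continuous
    prod_transition_smooth prod_metric prod_metric_smooth prod_metric_sym
    prod_metric_posdef prod_metric_change.

End Product.

Section LocalCurvature.
Variables (R : realType) (n : nat) (G : 'rV[R]_n -> 'M[R]_n).

(* The Levi-Civita connection: nabla_(d_i) d_j = \sum_k christoffel i j k *: d_k *)
Definition christoffel (i j k : 'I_n) (x : 'rV[R]_n) : R :=
  2^-1 * \sum_(l < n) invmx (G x) k l *
    (pderiv i (fun y => G y j l) x + pderiv j (fun y => G y i l) x
     - pderiv l (fun y => G y i j) x).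

(* R(d_i, d_j) d_l = nabla_i nabla_j d_l - nabla_j nabla_i d_l
                   = \sum_m curvature13 i j l m *: d_m *)
Definition curvature13 (i j l m : 'I_n) (x : 'rV[R]_n) : R :=
  pderiv i (christoffel j l m) x - pderiv j (christoffel i l m) x
  + \sum_(s < n) (christoffel j l s x * christoffel i s m x
                  - christoffel i l s x * christoffel j s m x).

(* R_ijkl = g(R(d_i, d_j) d_l, d_k), so that R_ijij is a sectional curvature
   in an orthonormal frame. *)
Definition riemann (x : 'rV[R]_n) (i j k l : 'I_n) : R :=
  \sum_(m < n) curvature13 i j l m x * G x m k.

Definition ricci (x : 'rV[R]_n) : 'M[R]_n :=
  \matrix_(j, l) \sum_(i < n) \sum_(k < n) invmx (G x) i k * riemann x i j k l.

End LocalCurvature.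

Section Curvature.
Variables (R : realType) (n : nat) (M : riemannian_manifold R n).

Definition coord (p : M) : 'rV[R]_n := chart (chart_at p) p.

Definition metric_at (p : M) : 'M[R]_n := metric (chart_at p) (coord p).

Definition riemann_at (p : M) : 'I_n -> 'I_n -> 'I_n -> 'I_n -> R :=
  riemann (metric (chart_at p)) (coord p).

Definition ricci_at (p : M) : 'M[R]_n := ricci (metric (chart_at p)) (coord p).

Definition einstein (rho : R) : Prop :=
  forall p : M, ricci_at p = rho *: metric_at p.

(* The vectors of the frame are the rows of [E]. *)
Definition orthonormal_frame (p : M) (E : 'M[R]_n) : Prop :=
  E *m metric_at p *m E^T = 1%:M.

Definition frame_riemann (p : M) (E : 'M[R]_n) (a b c d : 'I_n) : R :=
  \sum_(i < n) \sum_(j < n) \sum_(k < n) \sum_(l < n)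
    E a i * E b j * E c k * E d l * riemann_at p i j k l.

End Curvature.

Section SecondKind.
Variables (R : realType) (n : nat).

Definition S20 : {vspace 'M[R]_n} :=
  (lker (linfun (idfun \- @trmx R n n)) :&:
   lker (linfun (fun phi : 'M[R]_n => \tr phi : R^o)))%VS.

Lemma memS20 (phi : 'M[R]_n) : phi \in S20 = (phi^T == phi) && (\tr phi == 0).
Proof. by rewrite memv_cap !memv_ker !lfunE /= subr_eq0 eq_sym. Qed.

Definition tensor_dot (phi psi : 'M[R]_n) : R :=
  \sum_(i < n) \sum_(j < n) phi i j * psi i j.

Section Eigenspace.
Variable B : 'M[R]_n -> 'M[R]_n -> R.

(* [linfun f] agrees with [f] only when [f] is linear, so this is an eigenspace
   for bilinear [B]; see [mem_S20_eigenspace]. *)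
Definition S20_eigenspace (lam : R) : {vspace 'M[R]_n} :=
  (S20 :&: \bigcap_(psi <- vbasis S20)
     lker (linfun (fun phi => B phi psi - lam * tensor_dot phi psi : R^o)))%VS.

(* The multiplicity of [lam] as an eigenvalue, 0 if [lam] is not one. *)
Definition S20_multiplicity (lam : R) : nat := \dim (S20_eigenspace lam).

End Eigenspace.

Definition curvature_second_kind (T : 'I_n -> 'I_n -> 'I_n -> 'I_n -> R)
    (phi psi : 'M[R]_n) : R :=
  \sum_(i < n) \sum_(j < n) \sum_(k < n) \sum_(l < n)
    T i j k l * phi i l * psi j k.

Lemma eigen_defect_linearl T lam psi : linear (fun phi : 'M[R]_n =>
  curvature_second_kind T phi psi - lam * tensor_dot phi psi : R^o).
Proof.
move=> c u v; rewrite /curvature_second_kind /tensor_dot.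
have scE (x : R) : c *: (x : R^o) = c * x by [].
rewrite scE mulrBr mulrCA addrACA -opprD -mulrDr.
congr (_ - lam * _).
  rewrite mulr_sumr -big_split /=; apply: eq_bigr => i _.
  rewrite mulr_sumr -big_split /=; apply: eq_bigr => j _.
  rewrite mulr_sumr -big_split /=; apply: eq_bigr => k _.
  rewrite mulr_sumr -big_split /=; apply: eq_bigr => l _.
  by rewrite !mxE; ring.
rewrite mulr_sumr -big_split /=; apply: eq_bigr => i _.
rewrite mulr_sumr -big_split /=; apply: eq_bigr => j _.
by rewrite !mxE; ring.
Qed.

Lemma eigen_defect_linearr T lam phi : linear (fun psi : 'M[R]_n =>
  curvature_second_kind T phi psi - lam * tensor_dot phi psi : R^o).
Proof.
move=> c u v; rewrite /curvature_second_kind /tensor_dot.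
have scE (x : R) : c *: (x : R^o) = c * x by [].
rewrite scE mulrBr mulrCA addrACA -opprD -mulrDr.
congr (_ - lam * _).
  rewrite mulr_sumr -big_split /=; apply: eq_bigr => i _.
  rewrite mulr_sumr -big_split /=; apply: eq_bigr => j _.
  rewrite mulr_sumr -big_split /=; apply: eq_bigr => k _.
  rewrite mulr_sumr -big_split /=; apply: eq_bigr => l _.
  by rewrite !mxE; ring.
rewrite mulr_sumr -big_split /=; apply: eq_bigr => i _.
rewrite mulr_sumr -big_split /=; apply: eq_bigr => j _.
by rewrite !mxE; ring.
Qed.

Lemma mem_S20_eigenspace T lam phi :
  phi \in S20_eigenspace (curvature_second_kind T) lam <->
  phi \in S20 /\ forall psi, psi \in S20 ->
    curvature_second_kind T phi psi = lam * tensor_dot phi psi.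
Proof.
pose f psi : {linear 'M[R]_n -> R^o} := HB.pack
  (fun phi : 'M[R]_n =>
     curvature_second_kind T phi psi - lam * tensor_dot phi psi : R^o)
  (GRing.isLinear.Build _ _ _ _ _ (eigen_defect_linearl T lam psi)).
pose g : {linear 'M[R]_n -> R^o} := HB.pack
  (fun psi : 'M[R]_n =>
     curvature_second_kind T phi psi - lam * tensor_dot phi psi : R^o)
  (GRing.isLinear.Build _ _ _ _ _ (eigen_defect_linearr T lam phi)).
have capP (s : seq 'M[R]_n) : reflect (forall psi, psi \in s -> g psi = 0)
    (phi \in (\bigcap_(psi <- s) lker (linfun (f psi)))%VS).
  elim: s => [|psi s IHs].
    by rewrite big_nil memvf; apply: ReflectT.
  rewrite big_cons memv_cap memv_ker lfunE; apply: (iffP andP).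
    by move=> [/eqP e /IHs es] x; rewrite inE => /predU1P[->|/es].
  move=> e; split; first by apply/eqP/(e psi)/mem_head.
  by apply/IHs => x xs; apply: e; rewrite inE xs orbT.
rewrite memv_cap; split=> [/andP[-> /capP e]|[-> e]] /=.
  split=> // psi /coord_vbasis psiE; apply/eqP; rewrite -subr_eq0.
  rewrite -[_ - _]/(g psi) psiE linear_sum big1 // => i _.
  rewrite linearZ_LR e ?scaler0 //.
  by apply: mem_nth; rewrite size_tuple.
by apply/capP => psi /vbasis_mem /e eq; rewrite /g /= eq subrr.
Qed.

End SecondKind.

(* Main.v *)
Require Import Defs.
From HB Require Import structures.
From mathcomp Require Import all_boot all_order all_algebra.
From mathcomp Require Import all_classical all_reals all_analysis.
From mathcomp Require Import ring.

Set Implicit Arguments.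
Unset Strict Implicit.
Unset Printing Implicit Defensive.

Import Order.TTheory GRing.Theory Num.Theory.
Import numFieldNormedType.Exports.

Local Open Scope ring_scope.

(** At an adapted orthonormal frame, a traceless symmetric tensor on the
    tangent space of the product is a block matrix with blocks A, C, C^T, D and
    tr A + tr D = 0. The curvature tensor of the product has no mixed
    components ([coord_riemann_block_mixed]), so the form is the sum of the
    form of the first factor on the A blocks and of that of the second factor
    on the D blocks ([second_kind_prod_frame]). These arguments need not be
    traceless any more, and this is where the Einstein condition enters:
    contracting the identity into the form gives minus the Ricci tensor, so
    that the identity is orthogonal, for the form, to all traceless tensors
    ([einstein_second_kind1l], [einstein_second_kind1r]).

    Hence the splitting of the traceless tensors into traceless A, traceless D,
    mixed C and the line spanned by n2 g1 - n1 g2 is invariant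
    ([block_eigenspaceE]). The first two pieces carry the spectra of the
    factors, the mixed tensors lie in the kernel, and on the line the quotient
    of the form by the squared norm is - (n2^2 n1 rho1 + n1^2 n2 rho2) / (n2^2
    n1 + n1^2 n2), the last eigenvalue. Multiplicities do not depend on the
    orthonormal frame ([frame_change_multiplicity]), so an arbitrary frame of
    the product may be replaced by the adapted one.

    The analytic input is the antisymmetry of the curvature tensor in its last
    two indices, without which contracting the identity on the left would not
    yield the Ricci tensor. It says that second derivatives of the metric
    commute, that is, Schwarz's theorem ([derive_comm]), proved with second
    differences. The coordinate formula [riemannE] displays this antisymmetry,
    and it also yields the curvature of a block diagonal metric by inspection
    of the indices. *)

(** * Schwarz's theorem *)

Section Schwarz.
Local Open Scope classical_set_scope.
Local Open Scope ring_scope.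
Variables (R : realType) (V : normedModType R).
Implicit Types (f : V -> R) (x y u v : V) (h : R).

Lemma is_derive_line f x u (s : R) : derivable f (x + s *: u) u ->
  is_derive s 1 (fun t : R => f (x + t *: u)) ('D_u f (x + s *: u)).
Proof.
have E : (fun h : R => h^-1 *: (((fun t : R => f (x + t *: u)) \o shift s)
     (h *: 1) - f (x + s *: u))) =
  (fun h : R => h^-1 *: ((f \o shift (x + s *: u)) (h *: u) - f (x + s *: u))).
  apply/funext => h /=; congr (_ *: (f _ - _)).
  by rewrite [h *: 1]mulr1 scalerDl addrCA.
by move=> df; apply: DeriveDef; rewrite /derivable /derive E.
Qed.

Lemma MVT_line f x u h : 0 < h ->
  (forall s, 0 <= s <= h -> derivable f (x + s *: u) u) ->
  exists2 c, 0 <= c <= h & f (x + h *: u) - f x = 'D_u f (x + c *: u) * h.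
Proof.
move=> h0 df.
have D (s : R) : 0 <= s <= h ->
    is_derive s 1 (fun t : R => f (x + t *: u)) ('D_u f (x + s *: u)).
  by move=> /df; exact: is_derive_line.
have [s||c ch] := @MVT R (fun t => f (x + t *: u))
    (fun t => 'D_u f (x + t *: u)) 0 h h0.
- by rewrite in_itv /= => /andP[s0 sh]; apply: D; rewrite !ltW.
- apply: derivable_within_continuous => s; rewrite in_itv /= => /D ds.
  exact: ex_derive.
rewrite scale0r addr0 subr0; exists c => //.
by move: ch; rewrite in_itv /= => /andP[c0 ch]; rewrite !ltW.
Qed.

Lemma is_derive_increment f x u w : derivable f (x + w) u -> derivable f x u ->
  is_derive x u (fun y => f (y + w) - f y) ('D_u f (x + w) - 'D_u f x).
Proof.
move=> d1 d2; apply: (@is_deriveB _ _ _ (fun y => f (y + w)) f).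
  have E : (fun h : R => h^-1 *: (((fun y => f (y + w)) \o shift x) (h *: u)
      - f (x + w))) =
    (fun h : R => h^-1 *: ((f \o shift (x + w)) (h *: u) - f (x + w))).
    by apply/funext => h /=; rewrite addrA.
  by apply: DeriveDef; rewrite /derivable /derive E.
exact: derivableP.
Qed.

(** The mean value theorem is applied twice: in direction [u] to the increment
    of [f] along [h *: v], then in direction [v] to ['D_u f]. The left side is
    symmetric in [u] and [v], which is what makes [derive_comm] work. *)
Lemma second_difference f x u v h : 0 < h ->
  (forall s t, 0 <= s <= h -> 0 <= t <= h ->
     derivable f (x + s *: u + t *: v) u /\
     derivable ('D_u f) (x + s *: u + t *: v) v) ->
  exists c d, [/\ 0 <= c <= h, 0 <= d <= h &
    f (x + h *: u + h *: v) - f (x + h *: u) - (f (x + h *: v) - f x)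
    = 'D_v ('D_u f) (x + c *: u + d *: v) * h * h].
Proof.
move=> h0 df.
have h00 : 0 <= (0 : R) <= h by rewrite lexx ltW.
have hh : 0 <= h <= h by rewrite lexx ltW.
have dg s : 0 <= s <= h -> is_derive (x + s *: u) u
    (fun y => f (y + h *: v) - f y)
    ('D_u f (x + s *: u + h *: v) - 'D_u f (x + s *: u)).
  move=> sh; apply: is_derive_increment; first by have [] := df s h sh hh.
  by have [+ _] := df s 0 sh h00; rewrite scale0r addr0.
have [|c ch ->] := @MVT_line (fun y => f (y + h *: v) - f y) x u h h0.
  by move=> s /dg ds; exact: ex_derive.
have -> := @derive_val _ _ _ _ _ _ _ (dg c ch).
have [|d dh ->] := @MVT_line ('D_u f) (x + c *: u) v h h0.
  by move=> t th; have [] := df c t ch th.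
by exists c, d.
Qed.

Lemma near_square x u v (P : V -> Prop) : (\near x, P x) ->
  exists2 h, 0 < h &
    forall s t, 0 <= s <= h -> 0 <= t <= h -> P (x + s *: u + t *: v).
Proof.
move=> nP.
have cF : {for ((0, 0) : R * R),
    continuous (fun p : R * R => x + p.1 *: u + p.2 *: v)}.
  apply: cvgD; last by apply: cvgZr_tmp; exact: cvg_snd.
  by apply: cvgD; [exact: cvg_cst|apply: cvgZr_tmp; exact: cvg_fst].
have : nbhs ((0, 0) : R * R) [set p : R * R | P (x + p.1 *: u + p.2 *: v)].
  by apply: cF; rewrite /= !scale0r !addr0.
case=> -[A B] /= [/nbhs_ballP[a a0 aA] /nbhs_ballP[b b0 bB]] AB.
exists (Num.min a b / 2); first by rewrite divr_gt0// lt_min a0 b0.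
have mab : Num.min a b / 2 < Num.min a b.
  by rewrite ltr_pdivrMr// ltr_pMr ?ltr1n// lt_min a0 b0.
have sub (s e : R) : Num.min a b <= e -> 0 <= s <= Num.min a b / 2 ->
    ball (0 : R) e s.
  move=> mine /andP[s0 sm]; rewrite /ball /= sub0r normrN ger0_norm//.
  exact: le_lt_trans sm (lt_le_trans mab mine).
move=> s t hs ht; apply: (AB (s, t)); split => /=.
  by apply: aA; apply: sub => //; rewrite ge_min lexx.
by apply: bB; apply: sub => //; rewrite ge_min lexx orbT.
Qed.

(** Schwarz's theorem. The second difference over a small parallelogram at [x],
    divided by [h ^+ 2], is a value of ['D_v ('D_u f)] and also a value of
    ['D_u ('D_v f)], both taken close to [x]; continuity at [x] concludes. *)
Lemma derive_comm f x u v :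
  (\near x, derivable f x u /\ derivable ('D_u f) x v) ->
  (\near x, derivable f x v /\ derivable ('D_v f) x u) ->
  {for x, continuous ('D_v ('D_u f))} -> {for x, continuous ('D_u ('D_v f))} ->
  'D_v ('D_u f) x = 'D_u ('D_v f) x.
Proof.
move=> duv dvu cuv cvu; apply/eqP; rewrite -subr_eq0 -normr_le0.
apply/ler_addgt0Pl => e e0; rewrite addr0.
have e20 : 0 < e / 2 by rewrite divr_gt0.
have nuv : \forall y \near x, `|'D_v ('D_u f) x - 'D_v ('D_u f) y| < e / 2.
  by apply: cvgr_dist_lt e20; exact: cuv.
have nvu : \forall y \near x, `|'D_u ('D_v f) x - 'D_u ('D_v f) y| < e / 2.
  by apply: cvgr_dist_lt e20; exact: cvu.
(* Every point of a small parallelogram at x is good for both orders, so one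
   value of the second difference is close to both sides. *)
have [h h0 H] : exists2 h : R, 0 < h & forall s t, 0 <= s <= h -> 0 <= t <= h ->
    [/\ derivable f (x + s *: u + t *: v) u /\
          derivable ('D_u f) (x + s *: u + t *: v) v,
        derivable f (x + s *: u + t *: v) v /\
          derivable ('D_v f) (x + s *: u + t *: v) u,
        `|'D_v ('D_u f) x - 'D_v ('D_u f) (x + s *: u + t *: v)| < e / 2 &
        `|'D_u ('D_v f) x - 'D_u ('D_v f) (x + s *: u + t *: v)| < e / 2].
  apply: (@near_square x u v (fun y => [/\ derivable f y u /\
     derivable ('D_u f) y v, derivable f y v /\ derivable ('D_v f) y u,
     `|'D_v ('D_u f) x - 'D_v ('D_u f) y| < e / 2 &
     `|'D_u ('D_v f) x - 'D_u ('D_v f) y| < e / 2])).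
  have FF : Filter (nbhs x) by exact: nbhs_filter.
  apply: (@filterS2 V (nbhs x) FF _ _ _ _ (filterI duv dvu) (filterI nuv nvu)).
  by move=> y [? ?] [? ?].
have close (a b c d : R) : `|a - c| < e / 2 -> `|b - d| < e / 2 -> c = d ->
    `|a - b| <= e.
  move=> ac bd cd; rewrite -(subrKA c) (splitr e).
  by apply/(le_trans (ler_normD _ _))/ltW/ltrD; rewrite // cd distrC.
have swD (a b c d : R) : a - b - (c - d) = a - c - (b - d) by ring.
have sw s t : x + s *: v + t *: u = x + t *: u + s *: v by rewrite addrAC.
have [|c [d [ch dh Euv]]] := @second_difference f x u v h h0.
  by move=> s t sh th; have [] := H s t sh th.
have [|d' [c' [dh' ch' Evu]]] := @second_difference f x v u h h0.
  by move=> s t sh th; rewrite sw; have [] := H t s th sh.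
have [_ _ Huv _] := H c d ch dh.
have [_ _ _ Hvu] := H c' d' ch' dh'.
apply: (close _ _ _ _ Huv Hvu).
have hn0 : h != 0 by exact: lt0r_neq0.
apply: (mulIf hn0); apply: (mulIf hn0).
rewrite -(sw d' c'); apply: (etrans (esym Euv)); apply: etrans Evu.
by rewrite (sw h h) swD.
Qed.

End Schwarz.

(** * The Riemann tensor in coordinates *)

Section Derivability.
Variables (R : realType) (V : normedModType R).
Implicit Types (x v : V).

Lemma derivable_add (f g : V -> R) x v :
  derivable f x v -> derivable g x v -> derivable (fun y => f y + g y) x v.
Proof. by move=> df dg; have := @derivableD R V _ f g x v df dg. Qed.

Lemma derivable_mul (f g : V -> R) x v :
  derivable f x v -> derivable g x v -> derivable (fun y => f y * g y) x v.
Proof. by move=> df dg; have := @derivableM R V f g x v df dg. Qed.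

Lemma derivable_scale (c : R) (f : V -> R) x v :
  derivable f x v -> derivable (fun y => c * f y) x v.
Proof. by move=> df; have := @derivableZ R V _ f c x v df. Qed.

Lemma derivable_bigsum (I : Type) (r : seq I) (P : pred I) (F : I -> V -> R) x v :
  (forall i, derivable (F i) x v) ->
  derivable (fun y => \sum_(i <- r | P i) F i y) x v.
Proof.
move=> dF; elim: r => [|i r IHr].
  under eq_fun do rewrite big_nil.
  exact: (@derivable_cst R V R 0 x v).
under eq_fun do rewrite big_cons; case: (P i); last exact: IHr.
exact: (@derivable_add (F i) _ x v (dF i) IHr).
Qed.

Lemma derivable_bigprod (I : Type) (r : seq I) (P : pred I) (F : I -> V -> R) x v :
  (forall i, derivable (F i) x v) ->
  derivable (fun y => \prod_(i <- r | P i) F i y) x v.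
Proof.
move=> dF; elim: r => [|i r IHr].
  under eq_fun do rewrite big_nil.
  exact: (@derivable_cst R V R 1 x v).
under eq_fun do rewrite big_cons; case: (P i); last exact: IHr.
exact: (@derivable_mul (F i) _ x v (dF i) IHr).
Qed.

Lemma derivable_det n (A : V -> 'M[R]_n) x v :
  (forall i j, derivable (fun y => A y i j) x v) ->
  derivable (fun y => \det (A y)) x v.
Proof.
move=> dA; rewrite /determinant; apply: derivable_bigsum => s.
by apply: derivable_scale; apply: derivable_bigprod => i; exact: dA.
Qed.

(** Cramer's formula makes each entry a quotient of polynomials in the entries
    of [A]. Invertibility is needed near [x], and not only at [x], because
    [invmx] is the identity on singular matrices. *)
Lemma derivable_invmx n (A : V -> 'M[R]_n) x v i j :
  (forall i j, derivable (fun y => A y i j) x v) ->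
  (\forall y \near x, A y \in unitmx) ->
  derivable (fun y => invmx (A y) i j) x v.
Proof.
move=> dA uA.
have ux : \det (A x) != 0 by rewrite -unitfE; exact: (nbhs_singleton uA).
have dadj : derivable (fun y => (\adj (A y)) i j) x v.
  under eq_fun do rewrite mxE /cofactor.
  apply: derivable_scale; apply: derivable_det => k l.
  by under eq_fun do rewrite !mxE; exact: dA.
have ddet := derivable_det dA.
have dinv := @derivableV R V (fun y => \det (A y)) x v ux ddet.
apply: near_eq_derivable (derivable_mul dinv dadj).
by apply: filterS uA => y uy; rewrite /invmx uy [RHS]mxE.
Qed.

End Derivability.

Section CoordinateCurvature.
Local Open Scope classical_set_scope.
Local Open Scope ring_scope.
Variables (R : realType) (n : nat) (G : 'rV[R]_n -> 'M[R]_n) (U : set 'rV[R]_n).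

Let g (i j : 'I_n) : 'rV[R]_n -> R := fun y => G y i j.

(** Christoffel symbols of the first kind, g(nabla_j d_l, d_k). *)
Definition christoffel1 (j l k : 'I_n) (x : 'rV[R]_n) : R :=
  2^-1 * (pderiv j (g l k) x + pderiv l (g j k) x - pderiv k (g j l) x).

(** The classical expression of the Riemann tensor by second derivatives of the
    metric and Christoffel symbols of the first kind. Here the inverse metric
    is never differentiated, so both antisymmetries and the splitting over a
    product can be read off. *)
Definition coord_riemann (x : 'rV[R]_n) (i j k l : 'I_n) : R :=
  2^-1 * (pderiv i (pderiv l (g j k)) x - pderiv i (pderiv k (g j l)) x
          - pderiv j (pderiv l (g i k)) x + pderiv j (pderiv k (g i l)) x)
  + \sum_(m < n) \sum_(p < n) invmx (G x) m p *
      (christoffel1 i l p x * christoffel1 j k m x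
       - christoffel1 j l p x * christoffel1 i k m x).

Lemma christoffelE i j k x : christoffel G i j k x =
  \sum_(l < n) invmx (G x) k l * christoffel1 i j l x.
Proof.
by rewrite /christoffel mulr_sumr; apply: eq_bigr => l _; rewrite mulrCA.
Qed.

Hypothesis Uopen : open U.
Hypothesis Gsmooth : forall i j, smooth U (fun x => G x i j).
Hypothesis Gsym : forall x, U x -> (G x)^T = G x.
Hypothesis Gunit : forall x, U x -> G x \in unitmx.

Lemma near_U x : U x -> \forall y \near x, U y.
Proof. by move=> Ux; exact: open_nbhs_nbhs. Qed.

Lemma eq_pderiv i (f h : 'rV[R]_n -> R) : (forall x, U x -> f x = h x) ->
  forall x, U x -> pderiv i f x = pderiv i h x.
Proof.
move=> fh x Ux; apply: near_eq_derive.
by apply: filterS (near_U Ux); exact: fh.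
Qed.

Lemma derivable_metric i j k x : U x -> derivable (g i j) x (delta_mx 0 k).
Proof. by have [_ /(_ k)[+ _]] := Gsmooth i j 1; exact. Qed.

Lemma derivable_pderiv_metric i j k l x :
  U x -> derivable (pderiv k (g i j)) x (delta_mx 0 l).
Proof. by have [_ /(_ k)[_ [_ /(_ l)[+ _]]]] := Gsmooth i j 2; exact. Qed.

Lemma pderiv_metric_comm i j k l x : U x ->
  pderiv l (pderiv k (g i j)) x = pderiv k (pderiv l (g i j)) x.
Proof.
move=> Ux; have cont a b : {for x, continuous (pderiv a (pderiv b (g i j)))}.
  by have [_ /(_ b)[_ [_ /(_ a)[_ [+ _]]]]] := Gsmooth i j 2; exact.
apply: derive_comm; [| |exact: cont|exact: cont].
all: apply: filterS (near_U Ux) => y Uy.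
all: by split; [exact: derivable_metric|exact: derivable_pderiv_metric].
Qed.

Lemma metricC i j x : U x -> g i j x = g j i x.
Proof. by move=> Ux; rewrite /g -[in LHS](Gsym Ux) mxE. Qed.

Lemma pderiv_metricC i j k x : U x -> pderiv k (g i j) x = pderiv k (g j i) x.
Proof. by apply: eq_pderiv => y; exact: metricC. Qed.

Lemma invmx_metricC i j x : U x -> invmx (G x) i j = invmx (G x) j i.
Proof. by move=> Ux; rewrite -[in LHS](Gsym Ux) -trmx_inv mxE. Qed.

Lemma christoffel_lower j l k x : U x ->
  \sum_(m < n) christoffel G j l m x * G x m k = christoffel1 j l k x.
Proof.
move=> Ux.
transitivity (\sum_(p < n) (1%:M : 'M[R]_n) p k * christoffel1 j l p x).
  under eq_bigr do rewrite christoffelE mulr_suml.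
  rewrite exchange_big /=; apply: eq_bigr => p _.
  rewrite -(mulVmx (Gunit Ux)) mxE mulr_suml; apply: eq_bigr => m _.
  by rewrite (invmx_metricC m p Ux); exact: mulrAC.
rewrite (bigD1 k) //= big1 ?addr0 => [|p pk]; first by rewrite mxE eqxx mul1r.
by rewrite mxE (negbTE pk) mul0r.
Qed.

(** The Levi-Civita connection is metric: d_i g_mk is the sum of g(nabla_i d_m,
    d_k) and g(d_m, nabla_i d_k). *)
Lemma metric_compatible i m k x : U x ->
  pderiv i (g m k) x = christoffel1 i m k x + christoffel1 i k m x.
Proof.
by move=> Ux; rewrite /christoffel1 (pderiv_metricC k m i Ux); field.
Qed.

Lemma derivable_christoffel1 j l k i x : U x ->
  derivable (christoffel1 j l k) x (delta_mx 0 i).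
Proof.
move=> Ux; apply: derivable_scale; apply: derivableB; first apply: derivableD;
  exact: derivable_pderiv_metric.
Qed.

Lemma derivable_christoffel j l m i x : U x ->
  derivable (christoffel G j l m) x (delta_mx 0 i).
Proof.
move=> Ux; rewrite (_ : christoffel G j l m = fun y =>
    \sum_(p < n) invmx (G y) m p * christoffel1 j l p y); last first.
  by apply/funext => y; exact: christoffelE.
apply: derivable_bigsum => p.
apply: (@derivableM _ _ (fun y => invmx (G y) m p)).
  apply: derivable_invmx => [a b|]; first exact: derivable_metric.
  by apply: filterS (near_U Ux) => y /Gunit.
exact: derivable_christoffel1.
Qed.

Lemma pderiv_christoffel1 i j l k x : U x -> pderiv i (christoffel1 j l k) x =
  2^-1 * (pderiv i (pderiv j (g l k)) x + pderiv i (pderiv l (g j k)) x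
          - pderiv i (pderiv k (g j l)) x).
Proof.
move=> Ux; have dd := derivable_pderiv_metric.
rewrite {1}/pderiv (_ : christoffel1 j l k = 2^-1 \*:
  (pderiv j (g l k) + pderiv l (g j k) - pderiv k (g j l) : _ -> R)) //.
rewrite deriveZ; last by apply: derivableB; first apply: derivableD; exact: dd.
rewrite deriveB; [|by apply: derivableD; exact: dd|exact: dd].
by rewrite deriveD; [|exact: dd|exact: dd].
Qed.

(** Differentiating [christoffel_lower] trades the derivatives of the
    second-kind symbols, which involve the inverse metric, for those of the
    first-kind ones. *)
Lemma pderiv_christoffel i j l k x : U x ->
  \sum_(m < n) pderiv i (christoffel G j l m) x * G x m k =
  pderiv i (christoffel1 j l k) x
  - \sum_(m < n) christoffel G j l m x * pderiv i (g m k) x.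
Proof.
move=> Ux; apply/eqP; rewrite -subr_eq opprK; apply/eqP.
rewrite -big_split /= -(eq_pderiv i (christoffel_lower j l k) Ux).
rewrite {3}/pderiv (_ : (fun y => _) =
  \sum_(m < n) (christoffel G j l m * g m k)).
  rewrite derive_sum; last first.
    move=> m; apply: derivableM; first exact: derivable_christoffel.
    exact: derivable_metric.
  apply: eq_bigr => m _; rewrite deriveM; last 2 first.
  - exact: derivable_christoffel.
  - exact: derivable_metric.
  by rewrite addrC; congr (_ + _); exact: mulrC.
by apply/funext => y; rewrite fct_sumE.
Qed.

(** After lowering the index, [metric_compatible] cancels half of the quadratic
    terms. The two terms d_i d_j g_lk and d_j d_i g_lk that remain cancel by
    Schwarz's theorem. *)
Lemma riemannE x i j k l : U x -> riemann G x i j k l = coord_riemann x i j k l.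
Proof.
move=> Ux; rewrite /riemann /coord_riemann.
have E a b c d : \sum_(m < n) christoffel G a b m x * christoffel1 c d m x =
    \sum_(m < n) \sum_(p < n) invmx (G x) m p *
      (christoffel1 a b p x * christoffel1 c d m x).
  apply: eq_bigr => m _; rewrite christoffelE mulr_suml.
  by apply: eq_bigr => p _; exact: esym (mulrA _ _ _).
have -> : \sum_(m < n) curvature13 G i j l m x * G x m k =
    pderiv i (christoffel1 j l k) x - pderiv j (christoffel1 i l k) x
    + (\sum_(m < n) christoffel G i l m x * christoffel1 j k m x
       - \sum_(m < n) christoffel G j l m x * christoffel1 i k m x).
  have L a b : \sum_(m < n) (\sum_(s < n) christoffel G a l s x *
        christoffel G b s m x) * G x m k =
      \sum_(s < n) christoffel G a l s x * christoffel1 b s k x.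
    under eq_bigr do rewrite mulr_suml.
    rewrite exchange_big /=; apply: eq_bigr => s _.
    under eq_bigr do rewrite -mulrA.
    by rewrite -mulr_sumr christoffel_lower.
  have D a b : \sum_(m < n) pderiv a (christoffel G b l m) x * G x m k =
      pderiv a (christoffel1 b l k) x
      - \sum_(m < n) christoffel G b l m x * christoffel1 a m k x
      - \sum_(m < n) christoffel G b l m x * christoffel1 a k m x.
    rewrite pderiv_christoffel // -addrA -opprD -big_split /=.
    by congr (_ - _); apply: eq_bigr => m _; rewrite metric_compatible // mulrDr.
  transitivity (\sum_(m < n) (pderiv i (christoffel G j l m) x * G x m k
      - pderiv j (christoffel G i l m) x * G x m k
      + ((\sum_(s < n) christoffel G j l s x * christoffel G i s m x) * G x m k
      - (\sum_(s < n) christoffel G i l s x * christoffel G j s m x) * G x m k))).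
    apply: eq_bigr => m _; rewrite /curvature13 sumrB.
    by rewrite mulrDl !mulrBl.
  rewrite big_split /=.
  rewrite [X in X + _]sumrB [X in _ + X]sumrB.
  have C (s1 s2 s3 s4 a b c d e f : R) :
      s1 = a - c - d -> s2 = b - e - f -> s3 = c -> s4 = e ->
    s1 - s2 + (s3 - s4) = a - b + (f - d) by move=> -> -> -> ->; ring.
  exact: C (D i j) (D j i) (L j i) (L i j).
rewrite (E i l j k) (E j l i k) !(pderiv_christoffel1 _ _ _ _ Ux).
congr (_ + _).
  have C (a a' b c b' c' : R) : a = a' ->
      2^-1 * (a + b - c) - 2^-1 * (a' + b' - c') = 2^-1 * (b - c - b' + c').
    by move=> ->; ring.
  exact: C (pderiv_metric_comm l k j i Ux).
rewrite -sumrB; apply: eq_bigr => m _; rewrite -sumrB.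
by apply: eq_bigr => p _; rewrite -mulrBr.
Qed.

(** This antisymmetry is the one that rests on Schwarz's theorem; it is visible
    on the right side of [riemannE]. *)
Lemma riemann_asymr x i j k l : U x ->
  riemann G x i j l k = - riemann G x i j k l.
Proof.
move=> Ux; rewrite !(riemannE _ _ _ _ Ux).
have oppD (a b c d : R) : a = - b -> c = - d -> a + c = - (b + d).
  by move=> -> ->; rewrite opprD.
have swap (a b c d : R) : 2^-1 * (a - b - c + d) = - (2^-1 * (b - a - d + c)).
  by ring.
have swap2 (z a b c d : R) : z * (a * b - c * d) = - (z * (d * c - b * a)).
  by ring.
apply: oppD; first exact: swap.
rewrite exchange_big /= -sumrN; apply: eq_bigr => m _.
rewrite -sumrN; apply: eq_bigr => p _.
rewrite (invmx_metricC p m Ux); exact: swap2.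
Qed.

End CoordinateCurvature.

Lemma riemann_asyml (R : realType) (n : nat) (G : 'rV[R]_n -> 'M[R]_n) x
    (i j k l : 'I_n) : riemann G x j i k l = - riemann G x i j k l.
Proof.
rewrite /riemann -sumrN; apply: eq_bigr => m _; rewrite -mulNr; congr (_ * _).
rewrite /curvature13 opprD opprB; congr (_ + _).
by rewrite -sumrN; apply: eq_bigr => s _; rewrite opprB.
Qed.

(** * Curvature of a block diagonal metric *)

Section ProductCurvature.
Variables (R : realType) (n1 n2 : nat).

Definition block_metric (G1 : 'rV[R]_n1 -> 'M[R]_n1)
    (G2 : 'rV[R]_n2 -> 'M[R]_n2) (x : 'rV[R]_(n1 + n2)) : 'M[R]_(n1 + n2) :=
  block_mx (G1 (lsubmx x)) 0 0 (G2 (rsubmx x)).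

(** Tells from which factor of the product a coordinate comes: [true] for the
    first one. A tensor splits when it vanishes as soon as two of its indices
    have different sides. *)
Definition side (i : 'I_(n1 + n2)) : bool := (i < n1)%N.

Lemma side_lshift i : side (lshift n2 i) = true.
Proof. by rewrite /side /= ltn_ord. Qed.

Lemma side_rshift i : side (rshift n1 i) = false.
Proof. by rewrite /side /= ltnNge leq_addr. Qed.

Variables (G1 : 'rV[R]_n1 -> 'M[R]_n1) (G2 : 'rV[R]_n2 -> 'M[R]_n2).
Let G := block_metric G1 G2.

Lemma block_metric_ll i j : (fun y => G y (lshift n2 i) (lshift n2 j)) =
  (fun y => G1 y i j) \o lsubmx.
Proof. by apply/funext => y; rewrite /G /block_metric block_mxEul. Qed.

Lemma block_metric_rr i j : (fun y => G y (rshift n1 i) (rshift n1 j)) =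
  (fun y => G2 y i j) \o rsubmx.
Proof. by apply/funext => y; rewrite /G /block_metric block_mxEdr. Qed.

Lemma block_metric_lr i j :
  (fun y => G y (lshift n2 i) (rshift n1 j)) = cst 0.
Proof. by apply/funext => y; rewrite /G /block_metric block_mxEur mxE. Qed.

Lemma block_metric_rl i j :
  (fun y => G y (rshift n1 i) (lshift n2 j)) = cst 0.
Proof. by apply/funext => y; rewrite /G /block_metric block_mxEdl mxE. Qed.

Lemma pderiv_cst0 n (i : 'I_n) : pderiv i (cst 0 : 'rV[R]_n -> R) = cst 0.
Proof.
by apply/funext => x; rewrite /pderiv (@derive_cst R 'rV[R]_n R 0).
Qed.

Lemma pderiv_block_metric_ll k i j :
  pderiv (lshift n2 k) (fun y => G y (lshift n2 i) (lshift n2 j)) =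
  pderiv k (fun y => G1 y i j) \o lsubmx.
Proof. by rewrite block_metric_ll pderiv_lsubmx_l. Qed.

Lemma pderiv_block_metric_rr k i j :
  pderiv (rshift n1 k) (fun y => G y (rshift n1 i) (rshift n1 j)) =
  pderiv k (fun y => G2 y i j) \o rsubmx.
Proof. by rewrite block_metric_rr pderiv_rsubmx_r. Qed.

Lemma pderiv_block_metric_mixed k i j :
  ~~ ((side k == side i) && (side i == side j)) ->
  pderiv k (fun y => G y i j) = cst 0.
Proof.
case: (split_ordP k) => {}k ->; case: (split_ordP i) => {}i ->;
  case: (split_ordP j) => {}j ->; rewrite !(side_lshift, side_rshift) //= => _.
- by rewrite block_metric_lr pderiv_cst0.
- by rewrite block_metric_rl pderiv_cst0.
- by rewrite block_metric_rr pderiv_rsubmx_l.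
- by rewrite block_metric_ll pderiv_lsubmx_r.
- by rewrite block_metric_lr pderiv_cst0.
- by rewrite block_metric_rl pderiv_cst0.
Qed.

Lemma pderiv2_block_metric_mixed l k i j :
  ~~ [&& side l == side k, side k == side i & side i == side j] ->
  pderiv l (pderiv k (fun y => G y i j)) = cst 0.
Proof.
have [|ki] := boolP ((side k == side i) && (side i == side j)); last first.
  by rewrite (pderiv_block_metric_mixed ki) pderiv_cst0.
case: (split_ordP l) => {}l ->; case: (split_ordP k) => {}k ->;
  case: (split_ordP i) => {}i ->;
  case: (split_ordP j) => {}j ->; rewrite !(side_lshift, side_rshift) //= => _ _.
- by rewrite pderiv_block_metric_rr pderiv_rsubmx_l.
- by rewrite pderiv_block_metric_ll pderiv_lsubmx_r.
Qed.

Lemma christoffel1_block_ll j l k x :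
  christoffel1 G (lshift n2 j) (lshift n2 l) (lshift n2 k) x =
  christoffel1 G1 j l k (lsubmx x).
Proof. by rewrite /christoffel1 !pderiv_block_metric_ll. Qed.

Lemma christoffel1_block_rr j l k x :
  christoffel1 G (rshift n1 j) (rshift n1 l) (rshift n1 k) x =
  christoffel1 G2 j l k (rsubmx x).
Proof. by rewrite /christoffel1 !pderiv_block_metric_rr. Qed.

Lemma christoffel1_block_mixed j l k x :
  ~~ ((side j == side l) && (side l == side k)) -> christoffel1 G j l k x = 0.
Proof.
move=> jlk; rewrite /christoffel1 !pderiv_block_metric_mixed.
- by rewrite /= addr0 subr0 mulr0.
- by move: jlk; case: (side j); case: (side l); case: (side k).
- by move: jlk; case: (side j); case: (side l); case: (side k).
- by move: jlk; case: (side j); case: (side l); case: (side k).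
Qed.

Variable x : 'rV[R]_(n1 + n2).
Hypothesis G1unit : G1 (lsubmx x) \in unitmx.
Hypothesis G2unit : G2 (rsubmx x) \in unitmx.

Lemma invmx_block_metric : invmx (G x) =
  block_mx (invmx (G1 (lsubmx x))) 0 0 (invmx (G2 (rsubmx x))).
Proof.
have e : G x *m block_mx (invmx (G1 (lsubmx x))) 0 0 (invmx (G2 (rsubmx x)))
    = 1%:M.
  rewrite /G /block_metric mulmx_block !(mulmx0, mul0mx, addr0, add0r).
  by rewrite !mulmxV // -scalar_mx_block.
have [u _] := mulmx1_unit e.
by rewrite -[LHS]mulmx1 -e mulKmx.
Qed.

Lemma invmx_block_metric_mixed i j : side i != side j -> invmx (G x) i j = 0.
Proof.
rewrite invmx_block_metric.
case: (split_ordP i) => {}i ->; case: (split_ordP j) => {}j ->;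
  rewrite !(side_lshift, side_rshift) //= => _.
  by rewrite block_mxEur mxE.
by rewrite block_mxEdl mxE.
Qed.

Lemma coord_riemann_block_ll i j k l :
  coord_riemann G x (lshift n2 i) (lshift n2 j) (lshift n2 k) (lshift n2 l) =
  coord_riemann G1 (lsubmx x) i j k l.
Proof.
rewrite /coord_riemann !pderiv_block_metric_ll !pderiv_lsubmx_l.
congr (_ + _); rewrite big_split_ord /= [X in _ + X]big1 ?addr0; last first.
  move=> m _; apply: big1 => p _.
  by rewrite !(@christoffel1_block_mixed _ _ (rshift n1 m)) ?mulr0 ?subrr ?mulr0
             // !(side_lshift, side_rshift).
apply: eq_bigr => m _; rewrite big_split_ord /= [X in _ + X]big1 ?addr0.
  apply: eq_bigr => p _.
  by rewrite !christoffel1_block_ll invmx_block_metric block_mxEul.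
by move=> p _; rewrite invmx_block_metric block_mxEur mxE mul0r.
Qed.

Lemma coord_riemann_block_rr i j k l :
  coord_riemann G x (rshift n1 i) (rshift n1 j) (rshift n1 k) (rshift n1 l) =
  coord_riemann G2 (rsubmx x) i j k l.
Proof.
rewrite /coord_riemann !pderiv_block_metric_rr !pderiv_rsubmx_r.
congr (_ + _); rewrite big_split_ord /= [X in X + _]big1 ?add0r; last first.
  move=> m _; apply: big1 => p _.
  by rewrite !(@christoffel1_block_mixed _ _ (lshift n2 m)) ?mulr0 ?subrr ?mulr0
             // !(side_lshift, side_rshift).
apply: eq_bigr => m _; rewrite big_split_ord /= [X in X + _]big1 ?add0r.
  apply: eq_bigr => p _.
  by rewrite !christoffel1_block_rr invmx_block_metric block_mxEdr.
by move=> p _; rewrite invmx_block_metric block_mxEdl mxE mul0r.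
Qed.

(** A second derivative of the metric vanishes unless its four indices have the
    same side. In a quadratic term, each Christoffel symbol forces its three
    indices on one side, and the inverse metric forces the two summation
    indices [m] and [p] on one side, so that [i], [j], [k], [l] are again on
    one side. *)
Lemma coord_riemann_block_mixed i j k l :
  ~~ [&& side i == side j, side j == side k & side k == side l] ->
  coord_riemann G x i j k l = 0.
Proof.
move=> ijkl.
have quad a b c d m p :
    ~~ [&& side a == side b, side b == side c & side c == side d] ->
    invmx (G x) m p * (christoffel1 G a b p x * christoffel1 G c d m x) = 0.
  move=> abcd.
  have [mp|mp] := eqVneq (side m) (side p); last first.
    by rewrite invmx_block_metric_mixed // mul0r.
  have [abp|abp] := boolP ((side a == side b) && (side b == side p)); last first.
    by rewrite (christoffel1_block_mixed _ abp) mul0r mulr0.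
  have [cdm|cdm] := boolP ((side c == side d) && (side d == side m)); last first.
    by rewrite (christoffel1_block_mixed _ cdm) !mulr0.
  move: abcd abp cdm mp.
  by case: (side a); case: (side b); case: (side c); case: (side d);
     case: (side m); case: (side p).
rewrite /coord_riemann !pderiv2_block_metric_mixed.
- rewrite big1 => [|m _]; first by rewrite /= !(subr0, addr0, mulr0).
  apply: big1 => p _; rewrite mulrBr !quad ?subrr //;
    by move: ijkl; case: (side i); case: (side j); case: (side k); case: (side l).
all: by move: ijkl; case: (side i); case: (side j); case: (side k); case: (side l).
Qed.

End ProductCurvature.

Section BlockSum.
Variables (R : realType) (n1 n2 : nat).

Lemma sum_lshift (F : 'I_(n1 + n2) -> R) : (forall i, F (rshift n1 i) = 0) ->
  \sum_i F i = \sum_i F (lshift n2 i).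
Proof. by move=> F0; rewrite big_split_ord /= [X in _ + X]big1 ?addr0. Qed.

Lemma sum_rshift (F : 'I_(n1 + n2) -> R) : (forall i, F (lshift n2 i) = 0) ->
  \sum_i F i = \sum_i F (rshift n1 i).
Proof. by move=> F0; rewrite big_split_ord /= [X in X + _]big1 ?add0r. Qed.

Lemma curvature_second_kind_block
    (T : 'I_(n1 + n2) -> 'I_(n1 + n2) -> 'I_(n1 + n2) -> 'I_(n1 + n2) -> R)
    (T1 : 'I_n1 -> 'I_n1 -> 'I_n1 -> 'I_n1 -> R)
    (T2 : 'I_n2 -> 'I_n2 -> 'I_n2 -> 'I_n2 -> R) (X Y : 'M[R]_(n1 + n2)) :
  (forall i j k l, T (lshift n2 i) (lshift n2 j) (lshift n2 k) (lshift n2 l) =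
     T1 i j k l) ->
  (forall i j k l, T (rshift n1 i) (rshift n1 j) (rshift n1 k) (rshift n1 l) =
     T2 i j k l) ->
  (forall i j k l,
     ~~ [&& side i == side j, side j == side k & side k == side l] ->
     T i j k l = 0) ->
  curvature_second_kind T X Y =
    curvature_second_kind T1 (ulsubmx X) (ulsubmx Y) +
    curvature_second_kind T2 (drsubmx X) (drsubmx Y).
Proof.
move=> E1 E2 E0; rewrite /curvature_second_kind big_split_ord /=.
congr (_ + _); apply: eq_bigr => i _.
  rewrite sum_lshift => [|j]; last first.
    do 2 (apply: big1 => ? _).
    by rewrite E0 ?mul0r // side_lshift side_rshift.
  apply: eq_bigr => j _; rewrite sum_lshift => [|k]; last first.
    by apply: big1 => l _; rewrite E0 ?mul0r // !side_lshift side_rshift.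
  apply: eq_bigr => k _; rewrite sum_lshift => [|l]; last first.
    by rewrite E0 ?mul0r // !side_lshift side_rshift.
  by apply: eq_bigr => l _; rewrite E1 !mxE.
rewrite sum_rshift => [|j]; last first.
  do 2 (apply: big1 => ? _).
  by rewrite E0 ?mul0r // side_lshift side_rshift.
apply: eq_bigr => j _; rewrite sum_rshift => [|k]; last first.
  by apply: big1 => l _; rewrite E0 ?mul0r // !side_rshift side_lshift.
apply: eq_bigr => k _; rewrite sum_rshift => [|l]; last first.
  by rewrite E0 ?mul0r // !side_rshift side_lshift.
by apply: eq_bigr => l _; rewrite E2 !mxE.
Qed.

End BlockSum.

(** * Algebra of the curvature operator of the second kind *)

Section Symmetric.
Variables (R : realType) (n : nat).
Implicit Types (phi psi A P : 'M[R]_n) (T : 'I_n -> 'I_n -> 'I_n -> 'I_n -> R).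

Lemma second_kind_linearl T c phi phi' psi :
  curvature_second_kind T (c *: phi + phi') psi =
  c * curvature_second_kind T phi psi + curvature_second_kind T phi' psi.
Proof.
by have := eigen_defect_linearl T 0 psi c phi phi'; rewrite !mul0r !subr0.
Qed.

Lemma second_kind_linearr T c phi psi psi' :
  curvature_second_kind T phi (c *: psi + psi') =
  c * curvature_second_kind T phi psi + curvature_second_kind T phi psi'.
Proof.
by have := eigen_defect_linearr T 0 phi c psi psi'; rewrite !mul0r !subr0.
Qed.

Lemma second_kind0l T psi : curvature_second_kind T 0 psi = 0.
Proof.
rewrite /curvature_second_kind; do 4 (apply: big1 => ? _).
by rewrite mxE mulr0 mul0r.
Qed.

Lemma second_kind0r T phi : curvature_second_kind T phi 0 = 0.
Proof.
rewrite /curvature_second_kind; do 4 (apply: big1 => ? _).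
by rewrite mxE mulr0.
Qed.

Lemma tensor_dotE phi psi : tensor_dot phi psi = \tr (phi *m psi^T).
Proof.
by apply: eq_bigr => i _; rewrite mxE; apply: eq_bigr => j _; rewrite mxE.
Qed.

Lemma tensor_dotC phi psi : tensor_dot phi psi = tensor_dot psi phi.
Proof. by apply: eq_bigr => i _; apply: eq_bigr => j _; rewrite mulrC. Qed.

Lemma tensor_dot_linearl c phi phi' psi : tensor_dot (c *: phi + phi') psi =
  c * tensor_dot phi psi + tensor_dot phi' psi.
Proof. by rewrite !tensor_dotE mulmxDl -scalemxAl mxtraceD mxtraceZ. Qed.

Lemma tensor_dot_linearr c phi psi psi' : tensor_dot phi (c *: psi + psi') =
  c * tensor_dot phi psi + tensor_dot phi psi'.
Proof.
by rewrite !tensor_dotE linearP mulmxDr -scalemxAr mxtraceD mxtraceZ.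
Qed.

Lemma tensor_dot1l psi : tensor_dot 1%:M psi = \tr psi.
Proof. by rewrite tensor_dotE mul1mx mxtrace_tr. Qed.

Lemma tensor_dot1r phi : tensor_dot phi 1%:M = \tr phi.
Proof. by rewrite tensor_dotE trmx1 mulmx1. Qed.

Definition tracefree_part A : 'M[R]_n := - (\tr A / n%:R) *: 1%:M + A.

Lemma tracefree_partK A : (\tr A / n%:R) *: 1%:M + tracefree_part A = A.
Proof. by rewrite addrA -scalerDl subrr scale0r add0r. Qed.

Hypothesis n_gt0 : (0 < n)%N.

Lemma tracefree_part_S20 A : A^T = A -> tracefree_part A \in S20 R n.
Proof.
move=> sA; rewrite memS20 /tracefree_part linearP /= trmx1 sA eqxx /=.
rewrite mxtraceD mxtraceZ mxtrace1 mulNr divfK ?addNr //.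
by rewrite pnatr_eq0 -lt0n.
Qed.

Variables (T : 'I_n -> 'I_n -> 'I_n -> 'I_n -> R) (rho : R).
Hypothesis T1l : forall psi, curvature_second_kind T 1%:M psi = - rho * \tr psi.
Hypothesis T1r : forall phi, curvature_second_kind T phi 1%:M = - rho * \tr phi.

(** An eigentensor is tested on [S20] only; since the form, like the inner
    product, pairs traceless tensors to zero with the identity, the eigenvalue
    equation holds against all symmetric tensors. *)
Lemma eigenspace_sym lam A P :
  A \in S20_eigenspace (curvature_second_kind T) lam -> P^T = P ->
  curvature_second_kind T A P = lam * tensor_dot A P.
Proof.
move=> /mem_S20_eigenspace[SA eA] sP.
have /andP[_ /eqP trA] : (A^T == A) && (\tr A == 0) by rewrite -memS20.
rewrite -(tracefree_partK P) second_kind_linearr tensor_dot_linearr T1r.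
by rewrite tensor_dot1r trA !mulr0 !add0r; apply/eA/tracefree_part_S20.
Qed.

(** A multiple of the identity contributes to neither side of the equation when
    it is tested against traceless tensors, so it can be removed. *)
Lemma tracefree_part_eigenspace lam A : A^T = A ->
  (forall P, P \in S20 R n -> curvature_second_kind T A P = lam * tensor_dot A P)
  -> tracefree_part A \in S20_eigenspace (curvature_second_kind T) lam.
Proof.
move=> sA eA; apply/mem_S20_eigenspace; split; first exact: tracefree_part_S20.
move=> P SP; have /andP[_ /eqP trP] : (P^T == P) && (\tr P == 0) by rewrite -memS20.
rewrite second_kind_linearl tensor_dot_linearl T1l tensor_dot1l trP !mulr0 !add0r.
exact: eA.
Qed.

End Symmetric.

Section OrthogonalChange.
Variables (R : realType) (n : nat).

(** Conjugation by the orthogonal matrix [Q] is an isometry of [S20] that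
    carries one form to the other, hence embeds each eigenspace. *)
Lemma S20_multiplicity_le (T T' : 'I_n -> 'I_n -> 'I_n -> 'I_n -> R)
    (Q : 'M[R]_n) lam : Q *m Q^T = 1%:M ->
  (forall phi psi, curvature_second_kind T phi psi =
     curvature_second_kind T' (Q^T *m phi *m Q) (Q^T *m psi *m Q)) ->
  (S20_multiplicity (curvature_second_kind T) lam <=
   S20_multiplicity (curvature_second_kind T') lam)%N.
Proof.
move=> QQ TT'; have QQ' : Q^T *m Q = 1%:M by exact: mulmx1C.
pose f := linfun (mulmxr Q \o mulmx Q^T : 'M[R]_n -> 'M[R]_n).
have fE phi : f phi = Q^T *m phi *m Q by rewrite lfunE.
have fS20 (S : 'M[R]_n) phi : S *m S^T = 1%:M -> phi \in S20 R n ->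
    S^T *m phi *m S \in S20 R n.
  move=> SS; rewrite !memS20 => /andP[/eqP sphi /eqP trphi]; apply/andP; split.
    by rewrite !trmx_mul trmxK sphi mulmxA.
  by rewrite mxtrace_mulC mulmxA SS mul1mx trphi.
have injf : lker f == 0%VS.
  apply/lker0P => u v; rewrite !fE => e.
  have H w : Q *m (Q^T *m w *m Q) *m Q^T = w.
    by rewrite !mulmxA QQ mul1mx -mulmxA QQ mulmx1.
  by rewrite -(H u) e H.
rewrite /S20_multiplicity -(limg_dim_eq (f := f)); last first.
  by rewrite (eqP injf) capv0.
apply/dimvS/subvP => _ /memv_imgP[phi /mem_S20_eigenspace[Sphi ephi] ->].
apply/mem_S20_eigenspace; rewrite fE; split; first exact: fS20.
move=> psi Spsi.
have psiE : psi = Q^T *m (Q *m psi *m Q^T) *m Q.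
  by rewrite !mulmxA QQ' mul1mx -mulmxA QQ' mulmx1.
rewrite psiE -TT' ephi; last first.
  by have := fS20 Q^T psi; rewrite trmxK; exact.
congr (_ * _); rewrite -psiE !tensor_dotE !trmx_mul trmxK.
by rewrite -!mulmxA [RHS]mxtrace_mulC !mulmxA.
Qed.

Lemma S20_multiplicity_orthogonal (T T' : 'I_n -> 'I_n -> 'I_n -> 'I_n -> R)
    (Q : 'M[R]_n) lam : Q *m Q^T = 1%:M ->
  (forall phi psi, curvature_second_kind T phi psi =
     curvature_second_kind T' (Q^T *m phi *m Q) (Q^T *m psi *m Q)) ->
  S20_multiplicity (curvature_second_kind T) lam =
  S20_multiplicity (curvature_second_kind T') lam.
Proof.
move=> QQ TT'; have QQ' : Q^T *m Q = 1%:M by exact: mulmx1C.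
apply/eqP; rewrite eqn_leq (S20_multiplicity_le lam QQ TT') /=.
apply: (@S20_multiplicity_le _ _ Q^T); rewrite trmxK // => phi psi.
have H w : Q^T *m (Q *m w *m Q^T) *m Q = w.
  by rewrite !mulmxA QQ' mul1mx -mulmxA QQ' mulmx1.
by rewrite TT' !H.
Qed.

End OrthogonalChange.

Lemma mxtrace_gram_eq0 (R : realDomainType) m n (C : 'M[R]_(m, n)) :
  \tr (C *m C^T) = 0 -> C = 0.
Proof.
move=> trC; have C0 : \sum_i \sum_j C i j ^+ 2 = 0.
  rewrite -[RHS]trC; apply: eq_bigr => i _; rewrite mxE.
  by apply: eq_bigr => j _; rewrite mxE.
apply/matrixP => i j; apply/eqP; rewrite [X in _ == X]mxE -sqrf_eq0; apply/eqP.
have row0 : \sum_j C i j ^+ 2 = 0.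
  by apply: (psumr_eq0P _ C0) => // k _; apply: sumr_ge0 => l _; exact: sqr_ge0.
by apply: (psumr_eq0P _ row0) => // l _; exact: sqr_ge0.
Qed.

Section BlockEigenspace.
Variables (R : realType) (n1 n2 : nat).
Hypotheses (n1_gt0 : (0 < n1)%N) (n2_gt0 : (0 < n2)%N).

Definition ul_block (A : 'M[R]_n1) : 'M[R]_(n1 + n2) := block_mx A 0 0 0.
Definition dr_block (D : 'M[R]_n2) : 'M[R]_(n1 + n2) := block_mx 0 0 0 D.
Definition mixed_block (C : 'M[R]_(n1, n2)) : 'M[R]_(n1 + n2) :=
  block_mx 0 C C^T 0.
(** The traceless combination of the two metrics; it spans the eigenline of the
    new eigenvalue. *)
Definition balanced_block : 'M[R]_(n1 + n2) :=
  block_mx (n2%:R *: 1%:M) 0 0 (- n1%:R *: 1%:M).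

Fact ul_block_linear : linear ul_block.
Proof.
by move=> c A B; rewrite /ul_block scale_block_mx add_block_mx !scaler0 !addr0.
Qed.
HB.instance Definition _ := GRing.isLinear.Build R _ _ _ ul_block ul_block_linear.

Fact dr_block_linear : linear dr_block.
Proof.
by move=> c A B; rewrite /dr_block scale_block_mx add_block_mx !scaler0 !addr0.
Qed.
HB.instance Definition _ := GRing.isLinear.Build R _ _ _ dr_block dr_block_linear.

Fact mixed_block_linear : linear mixed_block.
Proof.
move=> c A B; rewrite /mixed_block scale_block_mx add_block_mx !scaler0 !addr0.
by rewrite linearP.
Qed.
HB.instance Definition _ :=
  GRing.isLinear.Build R _ _ _ mixed_block mixed_block_linear.

(** The orthogonal splitting of the traceless symmetric tensors on a direct
    sum: traceless tensors on each summand, mixed tensors, and the line of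
    [balanced_block]. *)
Lemma block_mx_decomposition (A : 'M[R]_n1) (C : 'M[R]_(n1, n2)) (D : 'M[R]_n2) :
  \tr A + \tr D = 0 ->
  block_mx A C C^T D =
  ul_block (tracefree_part A) + dr_block (tracefree_part D) + mixed_block C
  + (\tr A / (n1%:R * n2%:R)) *: balanced_block.
Proof.
move=> AD; have n1n0 : n1%:R != 0 :> R by rewrite pnatr_eq0 -lt0n.
have n2n0 : n2%:R != 0 :> R by rewrite pnatr_eq0 -lt0n.
have -> : \tr A / (n1%:R * n2%:R) = (\tr A / n1%:R) / n2%:R.
  by rewrite invfM mulrA.
rewrite /ul_block /dr_block /mixed_block /balanced_block scale_block_mx.
rewrite !add_block_mx !(scaler0, addr0, add0r) !scalerA.
congr block_mx.
  by rewrite divfK // addrC tracefree_partK.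
rewrite (_ : _ * - n1%:R = \tr D / n2%:R); first by rewrite addrC tracefree_partK.
have -> : \tr D = - \tr A by apply/eqP; rewrite -addr_eq0 addrC AD.
by field; rewrite n1n0 n2n0.
Qed.

Lemma ul_block_S20 A : A \in S20 R n1 -> ul_block A \in S20 R (n1 + n2).
Proof.
rewrite !memS20 => /andP[/eqP sA /eqP trA].
by rewrite tr_block_mx !trmx0 sA mxtrace_block trA mxtrace0 addr0 !eqxx.
Qed.

Lemma dr_block_S20 D : D \in S20 R n2 -> dr_block D \in S20 R (n1 + n2).
Proof.
rewrite !memS20 => /andP[/eqP sD /eqP trD].
by rewrite tr_block_mx !trmx0 sD mxtrace_block trD mxtrace0 addr0 !eqxx.
Qed.

Lemma tensor_dot_block (A A' : 'M[R]_n1) (B B' : 'M[R]_(n1, n2))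
    (C C' : 'M[R]_(n2, n1)) (D D' : 'M[R]_n2) :
  tensor_dot (block_mx A B C D) (block_mx A' B' C' D') =
  tensor_dot A A' + \tr (B *m B'^T) + (\tr (C *m C'^T) + tensor_dot D D').
Proof.
rewrite !tensor_dotE tr_block_mx mulmx_block mxtrace_block.
by rewrite !mxtraceD.
Qed.

Lemma block_S20P (phi : 'M[R]_(n1 + n2)) : phi \in S20 R (n1 + n2) ->
  exists A C D, [/\ phi = block_mx A C C^T D, A^T = A, D^T = D &
    \tr A + \tr D = 0].
Proof.
rewrite memS20 -{1 2}(submxK phi) tr_block_mx => /andP[/eqP/eq_block_mx].
move=> [sA sC _ sD] /eqP trphi.
exists (ulsubmx phi), (ursubmx phi), (drsubmx phi); split=> //.
  by rewrite -sC trmxK sC submxK.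
by rewrite -trphi -[in RHS](submxK phi) mxtrace_block.
Qed.

Variables (T1 : 'I_n1 -> 'I_n1 -> 'I_n1 -> 'I_n1 -> R) (rho1 : R).
Variables (T2 : 'I_n2 -> 'I_n2 -> 'I_n2 -> 'I_n2 -> R) (rho2 : R).
Variable (T : 'I_(n1 + n2) -> 'I_(n1 + n2) -> 'I_(n1 + n2) -> 'I_(n1 + n2) -> R).
Hypothesis T1l : forall psi, curvature_second_kind T1 1%:M psi = - rho1 * \tr psi.
Hypothesis T1r : forall phi, curvature_second_kind T1 phi 1%:M = - rho1 * \tr phi.
Hypothesis T2l : forall psi, curvature_second_kind T2 1%:M psi = - rho2 * \tr psi.
Hypothesis T2r : forall phi, curvature_second_kind T2 phi 1%:M = - rho2 * \tr phi.
Hypothesis T12 : forall phi psi, curvature_second_kind T phi psi =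
  curvature_second_kind T1 (ulsubmx phi) (ulsubmx psi) +
  curvature_second_kind T2 (drsubmx phi) (drsubmx psi).

Let mu := - ((n1%:R * rho2 + n2%:R * rho1) / (n1%:R + n2%:R)).

Let n12n0 : n1%:R + n2%:R != 0 :> R.
Proof. by rewrite -natrD pnatr_eq0 -lt0n addn_gt0 n1_gt0. Qed.

Lemma second_kind_block A C C' D A' B B' D' :
  curvature_second_kind T (block_mx A C C' D) (block_mx A' B B' D') =
  curvature_second_kind T1 A A' + curvature_second_kind T2 D D'.
Proof. by rewrite T12 !block_mxKul !block_mxKdr. Qed.

Local Notation W1 := (S20_eigenspace (curvature_second_kind T1)).
Local Notation W2 := (S20_eigenspace (curvature_second_kind T2)).
Local Notation W := (S20_eigenspace (curvature_second_kind T)).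

Lemma ul_block_eigen lam A : A \in W1 lam -> ul_block A \in W lam.
Proof.
move=> WA; have /mem_S20_eigenspace[SA _] := WA.
apply/mem_S20_eigenspace; split; first exact: ul_block_S20.
move=> psi /block_S20P[A' [C' [D' [-> sA' _ _]]]].
rewrite second_kind_block second_kind0l (eigenspace_sym n1_gt0 T1r WA sA').
rewrite tensor_dot_block.
by rewrite !mul0mx !mxtrace0 !tensor_dotE mul0mx mxtrace0 !addr0.
Qed.

Lemma dr_block_eigen lam D : D \in W2 lam -> dr_block D \in W lam.
Proof.
move=> WD; have /mem_S20_eigenspace[SD _] := WD.
apply/mem_S20_eigenspace; split; first exact: dr_block_S20.
move=> psi /block_S20P[A' [C' [D' [-> _ sD' _]]]].
rewrite second_kind_block second_kind0l (eigenspace_sym n2_gt0 T2r WD sD').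
rewrite tensor_dot_block.
by rewrite !mul0mx !mxtrace0 !tensor_dotE mul0mx mxtrace0 !add0r.
Qed.

Lemma mixed_block_eigen C : mixed_block C \in W 0.
Proof.
apply/mem_S20_eigenspace; split.
  by rewrite memS20 tr_block_mx !trmx0 trmxK mxtrace_block !mxtrace0 addr0 !eqxx.
move=> psi /block_S20P[A' [C' [D' [-> _ _ _]]]].
by rewrite second_kind_block !second_kind0l mul0r addr0.
Qed.

Lemma balanced_block_S20 : balanced_block \in S20 R (n1 + n2).
Proof.
rewrite memS20 tr_block_mx !trmx0 !linearZ /= !trmx1 mxtrace_block !mxtraceZ.
by rewrite !mxtrace1 eqxx /= mulNr mulrC subrr.
Qed.

Lemma tensor_dot_balancedl A C C' D : \tr A + \tr D = 0 ->
  tensor_dot balanced_block (block_mx A C C' D) = (n1%:R + n2%:R) * \tr A.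
Proof.
move=> AD; rewrite tensor_dot_block !mul0mx !mxtrace0 add0r addr0 !tensor_dotE.
rewrite -!scalemxAl !mul1mx !mxtraceZ !mxtrace_tr.
have -> : \tr D = - \tr A by apply/eqP; rewrite -addr_eq0 addrC AD.
by ring.
Qed.

Lemma second_kind_balancedl A C C' D : \tr A + \tr D = 0 ->
  curvature_second_kind T balanced_block (block_mx A C C' D) =
  mu * ((n1%:R + n2%:R) * \tr A).
Proof.
move=> AD; rewrite second_kind_block -[n2%:R *: _]addr0 -[- n1%:R *: _]addr0.
rewrite !second_kind_linearl !second_kind0l !addr0 T1l T2l.
have -> : \tr D = - \tr A by apply/eqP; rewrite -addr_eq0 addrC AD.
by rewrite /mu; field.
Qed.

Lemma second_kind_balancedr A C C' D : \tr A + \tr D = 0 ->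
  curvature_second_kind T (block_mx A C C' D) balanced_block =
  mu * ((n1%:R + n2%:R) * \tr A).
Proof.
move=> AD; rewrite second_kind_block -[n2%:R *: _]addr0 -[- n1%:R *: _]addr0.
rewrite !second_kind_linearr !second_kind0r !addr0 T1r T2r.
have -> : \tr D = - \tr A by apply/eqP; rewrite -addr_eq0 addrC AD.
by rewrite /mu; field.
Qed.

Lemma balanced_block_eigen : balanced_block \in W mu.
Proof.
apply/mem_S20_eigenspace; split; first exact: balanced_block_S20.
move=> psi /block_S20P[A' [C' [D' [-> _ _ tr0]]]].
by rewrite second_kind_balancedl // tensor_dot_balancedl.
Qed.

(** Each of the four pieces of [block_mx_decomposition] is invariant, so an
    eigentensor splits into eigentensors. The mixed piece has eigenvalue 0 and
    contributes only when [lam] is 0, and the line of [balanced_block] only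
    when [lam] is [mu]. *)
Lemma block_eigenspaceE lam : W lam =
  (linfun ul_block @: W1 lam + linfun dr_block @: W2 lam
   + (if lam == 0%R then limg (linfun mixed_block) else 0)
   + (if lam == mu then <[balanced_block]> else 0))%VS.
Proof.
apply/eqP; rewrite eqEsubv; apply/andP; split; last first.
  rewrite !subv_add; apply/andP; split; first (apply/andP; split).
  - apply/andP; split; apply/subvP => _ /memv_imgP[A WA ->]; rewrite lfunE.
      exact: ul_block_eigen.
    exact: dr_block_eigen.
  - case: eqP => [->|_]; last exact: sub0v.
    by apply/subvP => _ /memv_imgP[C _ ->]; rewrite lfunE; exact: mixed_block_eigen.
  - case: eqP => [->|_]; last exact: sub0v.
    by rewrite -memvE; exact: balanced_block_eigen.
apply/subvP => phi /mem_S20_eigenspace[/block_S20P[A [C [D [-> sA sD tr0]]]] eig].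
rewrite block_mx_decomposition //.
apply: memv_add; first apply: memv_add; first apply: memv_add.
- rewrite -[ul_block _]lfunE; apply: memv_img.
  apply: tracefree_part_eigenspace => // P SP.
  have := eig _ (ul_block_S20 SP).
  rewrite second_kind_block second_kind0r addr0 tensor_dot_block => ->.
  by rewrite !trmx0 !mulmx0 !mxtrace0 !tensor_dotE trmx0 mulmx0 mxtrace0 !addr0.
- rewrite -[dr_block _]lfunE; apply: memv_img.
  apply: tracefree_part_eigenspace => // P SP.
  have := eig _ (dr_block_S20 SP).
  rewrite second_kind_block second_kind0r add0r tensor_dot_block => ->.
  by rewrite !trmx0 !mulmx0 !mxtrace0 !tensor_dotE trmx0 mulmx0 mxtrace0 !add0r.
(* The form vanishes on mixed tensors: testing against the mixed part itself
   gives lam times its squared norm. *)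
- case: eqP => [_|/eqP lam0].
    by rewrite -[mixed_block _]lfunE; apply/memv_img/memvf.
  have SC : mixed_block C \in S20 R (n1 + n2).
    by have /mem_S20_eigenspace[] := mixed_block_eigen C.
  have := eig _ SC; rewrite second_kind_block !second_kind0r addr0 => /esym/eqP.
  rewrite mulf_eq0 (negbTE lam0) /= tensor_dot_block !tensor_dotE !trmx0 !mulmx0.
  rewrite !mxtrace0 addr0 add0r trmxK [X in _ + X]mxtrace_mulC -mulr2n mulrn_eq0 /=.
  by move=> /eqP /mxtrace_gram_eq0 ->; rewrite linear0 mem0v.
(* Testing against the balanced tensor gives (lam - mu) (n1 + n2) \tr A = 0. *)
- case: eqP => [_|/eqP lammu]; first exact/memvZ/memv_line.
  have := eig _ balanced_block_S20.
  rewrite second_kind_balancedr // tensor_dotC tensor_dot_balancedl // => /eqP.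
  rewrite eq_sym -subr_eq0 -mulrBl !mulf_eq0 subr_eq0 (negbTE lammu).
  by rewrite (negbTE n12n0) /= => /eqP ->; rewrite mul0r scale0r mem0v.
Qed.

Lemma capv_eq0P (U V : {vspace 'M[R]_(n1 + n2)}) :
  (forall u, u \in U -> u \in V -> u = 0) -> (U :&: V = 0)%VS.
Proof.
move=> UV; apply/eqP; rewrite -subv0; apply/subvP => u.
by rewrite memv_cap memv0 => /andP[uU uV]; apply/eqP/UV.
Qed.

Lemma block_multiplicity lam : S20_multiplicity (curvature_second_kind T) lam =
  (S20_multiplicity (curvature_second_kind T1) lam
   + S20_multiplicity (curvature_second_kind T2) lam
   + (lam == 0%R) * (n1 * n2) + (lam == mu))%N.
Proof.
have W1tr A : A \in W1 lam -> \tr A = 0.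
  by move=> /mem_S20_eigenspace[]; rewrite memS20 => /andP[_ /eqP].
have inj1 : lker (linfun ul_block) == 0%VS.
  apply/lker0P => A B; rewrite !lfunE /= => e.
  by rewrite -[A](block_mxKul _ 0 0 (0 : 'M[R]_n2)) -/(ul_block A) e block_mxKul.
have inj2 : lker (linfun dr_block) == 0%VS.
  apply/lker0P => A B; rewrite !lfunE /= => e.
  by rewrite -[A](block_mxKdr (0 : 'M[R]_n1) 0 0) -/(dr_block A) e block_mxKdr.
have inj3 : lker (linfun mixed_block) == 0%VS.
  apply/lker0P => A B; rewrite !lfunE /= => e.
  by rewrite -[A](block_mxKur (0 : 'M[R]_n1) _ A^T 0) -/(mixed_block A) e block_mxKur.
(* The three disjointness goals separate, in turn, by the upper left block, by
   the off-diagonal block, and by the trace of the upper left block. *)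
rewrite /S20_multiplicity block_eigenspaceE !dimv_disjoint_sum.
- rewrite !limg_dim_eq ?(eqP inj1) ?(eqP inj2) ?capv0 //.
  congr (_ + _ + _ + _)%N; case: eqP => _; rewrite ?dimv0 //.
    by rewrite limg_dim_eq ?(eqP inj3) ?capv0 // dimvf mul1n.
  rewrite dim_vline; case: eqP => //; rewrite -[0]block_mx0.
  move=> /eq_block_mx[/(congr1 mxtrace) + _ _ _].
  rewrite mxtraceZ mxtrace1 mxtrace0 => /eqP.
  by rewrite mulf_eq0 !pnatr_eq0 !gtn_eqF.
- apply: capv_eq0P => _ /memv_imgP[A _ ->] /memv_imgP[D _]; rewrite !lfunE /=.
  by move=> /eq_block_mx[-> _ _ _]; rewrite /ul_block block_mx0.
- apply: capv_eq0P => _ /memv_addP[_ /memv_imgP[A _ ->] [_ /memv_imgP[D _ ->] ->]].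
  case: eqP => _; last by rewrite memv0 => /eqP.
  move=> /memv_imgP[C _]; rewrite !lfunE /= add_block_mx !addr0 !add0r.
  by move=> /eq_block_mx[-> _ _ ->]; rewrite block_mx0.
- apply: capv_eq0P => u /memv_addP[_ /memv_addP[_ /memv_imgP[A WA ->]
     [_ /memv_imgP[D _ ->] ->]] [v Zv ->]].
  have [C ->] : exists C, v = mixed_block C.
    move: Zv; case: eqP => _.
      by move=> /memv_imgP[C _ ->]; exists C; rewrite lfunE.
    by rewrite memv0 => /eqP ->; exists 0; rewrite linear0.
  case: eqP => _; last by rewrite memv0 => /eqP.
  move=> /vlineP[c]; rewrite !lfunE /= => e.
  suff c0 : c = 0 by rewrite e c0 scale0r.
  have := congr1 (fun M => \tr (ulsubmx M)) e.
  rewrite scale_block_mx !add_block_mx !block_mxKul !addr0 W1tr // scalerA.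
  rewrite mxtraceZ mxtrace1 => /esym/eqP; rewrite !mulf_eq0 !pnatr_eq0.
  by rewrite !gtn_eqF //= !orbF => /eqP.
Qed.

End BlockEigenspace.

(** * Orthonormal frames on manifolds and on products *)

Section FrameCurvature.
Variables (R : realType) (n : nat) (M : riemannian_manifold R n) (p : M).

Let U := (chart (chart_at p) @` chart_dom (chart_at p))%classic.

Lemma coord_in_chart : U (Defs.coord p).
Proof. by exists p => //; exact: chart_dom_at. Qed.

Lemma metric_unitmx x : U x -> metric (chart_at p) x \in unitmx.
Proof.
move=> Ux; rewrite -row_free_unit -kermx_eq0; apply/eqP/row_matrixP => i.
rewrite row0; apply/eqP; apply: contraT => /(metric_posdef Ux).
by rewrite -row_mul mulmx_ker row0 mul0mx mxE ltxx.
Qed.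

Lemma riemann_atE i j k l : riemann_at p i j k l =
  coord_riemann (metric (chart_at p)) (Defs.coord p) i j k l.
Proof.
apply: (@riemannE _ _ _ U); [exact: chart_img_open|exact: metric_smooth|
  exact: Defs.metric_sym|exact: metric_unitmx|exact: coord_in_chart].
Qed.

Lemma riemann_at_asymr i j k l : riemann_at p i j l k = - riemann_at p i j k l.
Proof.
apply: (@riemann_asymr _ _ _ U); [exact: chart_img_open|exact: metric_smooth|
  exact: Defs.metric_sym|exact: metric_unitmx|exact: coord_in_chart].
Qed.

Lemma riemann_at_asyml i j k l : riemann_at p j i k l = - riemann_at p i j k l.
Proof. exact: riemann_asyml. Qed.

Lemma sum4_pair (F : 'I_n -> 'I_n -> 'I_n -> 'I_n -> R) :
  \sum_i \sum_j \sum_k \sum_l F i j k l =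
  \sum_(q : ('I_n * 'I_n) * ('I_n * 'I_n)) F q.1.1 q.1.2 q.2.1 q.2.2.
Proof.
rewrite pair_big /=; under eq_bigr do rewrite pair_big /=.
by rewrite pair_big.
Qed.

(** Changing the frame amounts to conjugating the two arguments; this serves
    for every change of frame below. *)
Lemma second_kind_frame (E phi psi : 'M[R]_n) :
  curvature_second_kind (frame_riemann p E) phi psi =
  curvature_second_kind (riemann_at p) (E^T *m phi *m E) (E^T *m psi *m E).
Proof.
have congrE (S : 'M[R]_n) i l : (E^T *m S *m E) i l =
    \sum_a \sum_d E a i * S a d * E d l.
  rewrite mxE exchange_big /=; apply: eq_bigr => d _.
  by rewrite mxE mulr_suml; apply: eq_bigr => a _; rewrite mxE.
have prod4 (A B : 'I_n -> 'I_n -> R) :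
    (\sum_a \sum_d A a d) * (\sum_b \sum_c B b c) =
    \sum_a \sum_b \sum_c \sum_d A a d * B b c.
  rewrite mulr_suml; apply: eq_bigr => a _.
  rewrite mulr_sumr; apply: eq_bigr => b _.
  rewrite mulr_sumr; apply: eq_bigr => c _.
  by rewrite mulr_suml.
rewrite /curvature_second_kind /frame_riemann !sum4_pair.
under eq_bigr do rewrite sum4_pair !mulr_suml.
rewrite exchange_big /=; apply: eq_bigr => q _.
rewrite -mulrA !congrE prod4 sum4_pair mulr_sumr; apply: eq_bigr => r _.
by ring.
Qed.

Variable E : 'M[R]_n.
Hypothesis orthoE : orthonormal_frame p E.

Lemma orthonormal_frame_invmx : invmx (metric_at p) = E^T *m E.
Proof.
have e : E^T *m E *m metric_at p = 1%:M.
  by rewrite -mulmxA; apply: mulmx1C.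
have [_ u] := mulmx1_unit e.
by rewrite -[RHS]mulmx1 -(mulmxV u) mulmxA e mul1mx.
Qed.

Lemma mxtrace_frame (phi : 'M[R]_n) :
  \sum_i \sum_j (E^T *m phi *m E) i j * metric_at p i j = \tr phi.
Proof.
rewrite -[LHS]/(tensor_dot _ _) tensor_dotE /metric_at Defs.metric_sym; last first.
  exact: coord_in_chart.
have E1 : E *m (metric_at p *m E^T) = 1%:M by rewrite mulmxA.
by rewrite -!mulmxA mxtrace_mulC -!mulmxA E1 mulmx1.
Qed.

Variable rho : R.
Hypothesis einsteinM : einstein M rho.

(** Contracting the two middle indices of the Riemann tensor gives minus the
    Ricci tensor, which is minus [rho] times the metric. *)
Lemma einstein_second_kind1r (phi : 'M[R]_n) :
  curvature_second_kind (frame_riemann p E) phi 1%:M = - rho * \tr phi.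
Proof.
have rearrange (r x g : R) : r * x * g = - (x * (g * - r)) by ring.
rewrite second_kind_frame mulmx1 -orthonormal_frame_invmx -(mxtrace_frame phi).
rewrite mulNr mulr_sumr -sumrN; apply: eq_bigr => i _.
under eq_bigr do rewrite exchange_big /=.
rewrite exchange_big /= mulr_sumr -sumrN; apply: eq_bigr => l _.
have := congr1 (fun A : 'M[R]_n => A i l) (einsteinM p).
rewrite !mxE => rhoE.
rewrite mulrCA -rhoE mulr_sumr -sumrN; apply: eq_bigr => j _.
rewrite mulr_sumr -sumrN; apply: eq_bigr => k _.
rewrite [X in _ * (_ * X)](riemann_at_asyml i j k l).
exact: rearrange.
Qed.

(** The contraction is now over the first and last indices, so antisymmetry in
    the last pair replaces antisymmetry in the first pair. *)
Lemma einstein_second_kind1l (psi : 'M[R]_n) :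
  curvature_second_kind (frame_riemann p E) 1%:M psi = - rho * \tr psi.
Proof.
have rearrange (r g y : R) : r * g * y = - (y * (g * - r)) by ring.
rewrite second_kind_frame mulmx1 -orthonormal_frame_invmx -(mxtrace_frame psi).
rewrite mulNr mulr_sumr -sumrN /curvature_second_kind exchange_big /=.
apply: eq_bigr => j _.
rewrite exchange_big /= mulr_sumr -sumrN; apply: eq_bigr => k _.
have := congr1 (fun A : 'M[R]_n => A j k) (einsteinM p).
rewrite !mxE => rhoE.
rewrite mulrCA -rhoE mulr_sumr -sumrN; apply: eq_bigr => i _.
rewrite mulr_sumr -sumrN; apply: eq_bigr => l _.
rewrite [X in _ * (_ * X)](riemann_at_asymr i j k l).
exact: rearrange.
Qed.

End FrameCurvature.

Section ProductFrame.
Variables (R : realType) (n1 n2 : nat).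
Variables (M1 : riemannian_manifold R n1) (M2 : riemannian_manifold R n2).
Variables (p1 : M1) (p2 : M2) (E1 : 'M[R]_n1) (E2 : 'M[R]_n2).
Let M := prod_manifold M1 M2.
Let p : M := (p1, p2).

Lemma prod_coord : Defs.coord p = row_mx (Defs.coord p1) (Defs.coord p2).
Proof. by []. Qed.

Lemma second_kind_prod_riemann (X Y : 'M[R]_(n1 + n2)) :
  curvature_second_kind (riemann_at p) X Y =
  curvature_second_kind (riemann_at p1) (ulsubmx X) (ulsubmx Y) +
  curvature_second_kind (riemann_at p2) (drsubmx X) (drsubmx Y).
Proof.
have e1 : lsubmx (Defs.coord p) = Defs.coord p1 by exact: row_mxKl.
have e2 : rsubmx (Defs.coord p) = Defs.coord p2 by exact: row_mxKr.
have u1 : metric (chart_at p1) (lsubmx (Defs.coord p)) \in unitmx.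
  by rewrite e1; apply/metric_unitmx/coord_in_chart.
have u2 : metric (chart_at p2) (rsubmx (Defs.coord p)) \in unitmx.
  by rewrite e2; apply/metric_unitmx/coord_in_chart.
apply: curvature_second_kind_block => [i j k l|i j k l|i j k l mixed].
- rewrite !riemann_atE; rewrite -[in RHS]e1; exact: coord_riemann_block_ll.
- rewrite !riemann_atE; rewrite -[in RHS]e2; exact: coord_riemann_block_rr.
- by rewrite riemann_atE; exact: (coord_riemann_block_mixed u1 u2 mixed).
Qed.

Lemma second_kind_prod_frame (phi psi : 'M[R]_(n1 + n2)) :
  curvature_second_kind (frame_riemann p (block_mx E1 0 0 E2)) phi psi =
  curvature_second_kind (frame_riemann p1 E1) (ulsubmx phi) (ulsubmx psi) +
  curvature_second_kind (frame_riemann p2 E2) (drsubmx phi) (drsubmx psi).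
Proof.
rewrite !second_kind_frame second_kind_prod_riemann.
have H (S : 'M[R]_(n1 + n2)) :
    (block_mx E1 0 0 E2)^T *m S *m block_mx E1 0 0 E2 =
    block_mx (E1^T *m ulsubmx S *m E1) (E1^T *m ursubmx S *m E2)
             (E2^T *m dlsubmx S *m E1) (E2^T *m drsubmx S *m E2).
  rewrite -{1}(submxK S) tr_block_mx !trmx0 !mulmx_block.
  by rewrite !(mul0mx, mulmx0, addr0, add0r).
by rewrite !H !block_mxKul !block_mxKdr.
Qed.

Lemma prod_orthonormal_frame :
  orthonormal_frame p1 E1 -> orthonormal_frame p2 E2 ->
  orthonormal_frame p (block_mx E1 0 0 E2).
Proof.
move=> o1 o2; rewrite /orthonormal_frame.
have -> : metric_at p = block_mx (metric_at p1) 0 0 (metric_at p2).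
  by rewrite /metric_at prod_coord /= /prod_metric row_mxKl row_mxKr.
rewrite tr_block_mx !trmx0 !mulmx_block !(mul0mx, mulmx0, addr0, add0r).
by rewrite o1 o2 -scalar_mx_block.
Qed.

End ProductFrame.

(** Two orthonormal frames at a point differ by an orthogonal matrix, so the
    spectrum may be computed in a frame adapted to the product. *)
Lemma frame_change_multiplicity (R : realType) n (M : riemannian_manifold R n)
    (p : M) (E F : 'M[R]_n) lam :
  orthonormal_frame p E -> orthonormal_frame p F ->
  S20_multiplicity (curvature_second_kind (frame_riemann p E)) lam =
  S20_multiplicity (curvature_second_kind (frame_riemann p F)) lam.
Proof.
move=> oE oF; have uF : F \in unitmx.
  by have := mulmx1_unit (etrans (mulmxA _ _ _) oF) => -[].
pose Q := E *m invmx F; have QF : Q *m F = E by rewrite mulmxKV.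
apply: (@S20_multiplicity_orthogonal _ _ _ _ Q) => [|phi psi].
  have <- : Q *m F *m metric_at p *m (Q *m F)^T = 1%:M by rewrite QF.
  have -> : Q *m F *m metric_at p *m (Q *m F)^T =
      Q *m (F *m metric_at p *m F^T) *m Q^T by rewrite trmx_mul !mulmxA.
  by rewrite oF mulmx1.
by rewrite !second_kind_frame -QF !trmx_mul !mulmxA.
Qed.

Theorem theorem1p8 (R : realType) (n1 n2 : nat) (hn1 : (0 < n1)%N)
    (hn2 : (0 < n2)%N) (M1 : riemannian_manifold R n1)
    (M2 : riemannian_manifold R n2) (rho1 rho2 : R)
    (hM1 : einstein M1 rho1) (hM2 : einstein M2 rho2)
    (p1 : M1) (p2 : M2)
    (E1 : 'M[R]_n1) (hE1 : orthonormal_frame p1 E1)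
    (E2 : 'M[R]_n2) (hE2 : orthonormal_frame p2 E2)
    (E : 'M[R]_(n1 + n2))
    (hE : orthonormal_frame (M := prod_manifold M1 M2) (p1, p2) E)
    (lam : R) :
  let mult1 := S20_multiplicity (curvature_second_kind (frame_riemann p1 E1)) in
  let mult2 := S20_multiplicity (curvature_second_kind (frame_riemann p2 E2)) in
  let mult := S20_multiplicity (curvature_second_kind
                (frame_riemann (M := prod_manifold M1 M2) (p1, p2) E)) in
  let mu := - ((n1%:R * rho2 + n2%:R * rho1) / (n1%:R + n2%:R)) in
  mult lam =
    (mult1 lam + mult2 lam + (lam == 0%R) * (n1 * n2) + (lam == mu))%N.
Proof.
move=> mult1 mult2 mult mu; rewrite /mult.
(* Pass to the frame adapted to the product. *)
rewrite (frame_change_multiplicity lam hE (prod_orthonormal_frame hE1 hE2)).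
apply: block_multiplicity => // [psi|phi|psi|phi|phi psi].
- exact: einstein_second_kind1l.
- exact: einstein_second_kind1r.
- exact: einstein_second_kind1l.
- exact: einstein_second_kind1r.
- exact: second_kind_prod_frame.
Qed.
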